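(* For every integer $n\ge 12$ and every square graph $G$ of degree $12$ on $\{1,\dots,n\}$ one has $\Lambda_n(\widetilde G)\ge 0$. On the other hand (for $n\ge 12$), $$\Lambda_n(\Delta_{n,4})=-\frac{2654208\,Q(n)}{n^6(n-3)^2(n-2)^4(n-1)^5},$$ where $$Q(n)=n^6-36n^5+376n^4-1920n^3+5635n^2-9456n+6912.$$ In particular, $\Lambda_n(\Delta_{n,4})<0$ for every $n\ge 23$.
   Context: Let $x_1,\dots,x_n$ be indeterminates and $P(t)=\prod_{i=1}^n(t-x_i)$. Put $J_{n,4}(t)=\frac{4!}{n!}P^{(n-4)}(t)$ (a monic quartic in $t$) and $\Delta_{n,4}=\operatorname{disc}(J_{n,4})$, a symmetric translation-invariant homogeneous polynomial of degree $12$ in $x_1,\dots,x_n$. For a loopless multigraph $G$ on the vertex set $\{1,\dots,n\}$ with chosen edge orientations, set $M_G=\prod_{(i,j)\in E(G)}(x_i-x_j)$ (edges counted with multiplicity) and $\widetilde G=\sum_{\sigma\in S_n}M_G(x_{\sigma(1)},\dots,x_{\sigma(n)})$. $G$ is a square graph if every edge has even multiplicity; its degree is the number of edges counted with multiplicity. For a homogeneous symmetric polynomial $F$ of degree $12$ in $x_1,\dots,x_n$ write $F=\sum_{\lambda\vdash 12}c_\lambda(F)m_\lambda$, where $m_\lambda$ is the monomial symmetric polynomial (partitions with more than $n$ parts are absent). For $n\ge 12$ define the linear functional $$\Lambda_n(F)=96\bigl(c_{(12)}+c_{(10,2)}-c_{(9,3)}+c_{(8,4)}+c_{(8,2,2)}-c_{(7,5)}-c_{(7,3,2)}+c_{(6,6)}+c_{(5,4,3)}\bigr)+32c_{(4,4,4)}+(n-3)c_{(3,3,3,3)},$$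 where $c_\lambda=c_\lambda(F)$. *)

(* Defs.v *)
From HB Require Import structures.
From mathcomp Require Import all_boot all_order all_algebra all_fingroup.
From mathcomp Require Import mpoly.

Set Implicit Arguments.
Unset Strict Implicit.
Unset Printing Implicit Defensive.

Import Order.TTheory GRing.Theory Num.Theory.
Local Open Scope ring_scope.

(* Discriminant of a monic polynomial p of degree d = (size p).-1, with the   *)
(* usual normalisation (-1)^(d(d-1)/2) Res(p, p').  The Sylvester matrix of   *)
(* mxpoly lists coefficients in increasing degree; this changes the resultant *)
(* of p and q by (-1)^(deg p * deg q), which is 1 when q = p' has degree d-1. *)
Definition disc_monic (R : comNzRingType) (p : {poly R}) : R :=
  (-1) ^+ 'C((size p).-1, 2) * resultant p p^`().

Definition genericP (n : nat) : {poly {mpoly rat[n]}} :=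
  \prod_(i < n) ('X - ('X_i : {mpoly rat[n]})%:P).

Definition J (n k : nat) : {poly {mpoly rat[n]}} :=
  (k`!%:R / n`!%:R)%:MP *: (genericP n)^`(n - k).

Definition Delta (n k : nat) : {mpoly rat[n]} := disc_monic (J n k).

(* Loopless multigraph on 'I_n: [mult G i j] is the multiplicity of the       *)
(* (undirected) edge {i, j}.                                                  *)
Record multigraph (n : nat) := Multigraph {
  mult : 'I_n -> 'I_n -> nat;
  mult_sym : forall i j, mult i j = mult j i;
  mult_loopless : forall i, mult i i = 0%N
}.

(* [o i j] means that {i, j} is oriented as (i, j).  Parallel edges share     *)
(* their orientation, so the product below is over pairs i, j, each taken to  *)
(* the power of its multiplicity; loops have multiplicity 0.                  *)
Definition orientation (n : nat) (o : rel 'I_n) : Prop :=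
  forall i j, i != j -> o i j = ~~ o j i.

Definition graph_monomial (n : nat) (G : multigraph n) (o : rel 'I_n) :
    {mpoly rat[n]} :=
  \prod_(i < n) \prod_(j < n | o i j) ('X_i - 'X_j) ^+ mult G i j.

Definition graph_degree (n : nat) (G : multigraph n) : nat :=
  (\sum_(i < n) \sum_(j < n | (i < j)%N) mult G i j)%N.

Definition square_graph (n : nat) (G : multigraph n) : Prop :=
  forall i j, ~~ odd (mult G i j).

(* [msym s p] is p(x_{s 1}, ..., x_{s n}).                                    *)
Definition symmetrization (n : nat) (p : {mpoly rat[n]}) : {mpoly rat[n]} :=
  \sum_(s : 'S_n) msym s p.

(* A partition with at most n parts is encoded by its list of parts, or by    *)
(* the exponent x^lam it defines once padded with zeros.  The value is        *)
(* meaningless if lam has more than n nonzero parts.                          *)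
Definition mnm_of_part (n : nat) (lam : seq nat) : 'X_{1..n} :=
  [multinom nth 0%N lam i | i < n].

Definition is_part_mnm (n : nat) (d : nat) (m : 'X_{1..n}) : bool :=
  (mdeg m == d) && sorted geq m.

(* Monomial symmetric polynomial: the sum of the distinct rearrangements of   *)
(* x^m.                                                                       *)
Definition monomial_sym (n : nat) (m : 'X_{1..n}) : {mpoly rat[n]} :=
  \sum_(k : 'X_{1..n < (mdeg m).+1} | perm_eq k m) 'X_[k].

(* c_lam(F): the coefficient of F on m_lam, see [sym_expansion] and           *)
(* [sym_expansion_uniq].                                                      *)
Definition sym_coef (n : nat) (F : {mpoly rat[n]}) (lam : seq nat) : rat :=
  F@_(mnm_of_part n lam).

Lemma mcoeff_monomial_sym (n : nat) (m k : 'X_{1..n}) :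
  (monomial_sym m)@_k = (perm_eq k m)%:R.
Proof.
rewrite /monomial_sym raddf_sum /=.
have mdegP (a b : 'X_{1..n}) : perm_eq a b -> mdeg a = mdeg b.
  by move=> ab; rewrite /mdeg; apply: perm_big.
case: (boolP (perm_eq k m)) => [km|nkm].
  have lt_k : (mdeg k < (mdeg m).+1)%N by rewrite (mdegP _ _ km).
  rewrite (bigD1 (BMultinom lt_k)) //= mcoeffX eqxx big1 ?addr0 //.
  move=> i /andP[_ ne]; rewrite mcoeffX; case: eqP => // ik.
  by case/negP: ne; apply/eqP/val_inj.
rewrite big1 // => i im; rewrite mcoeffX; case: eqP => // ik.
by rewrite -ik im in nkm.
Qed.

Lemma mnm_sort (n : nat) (m : 'X_{1..n}) :
  exists s : 'S_n, sorted geq [multinom m (s i) | i < n].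
Proof.
have /tuple_permP[s sE] : perm_eq (sort_tuple geq m) m by rewrite perm_sort.
exists s.
have -> : [multinom m (s i) | i < n] = sort geq m :> seq nat.
  by rewrite [RHS]sE; apply: eq_map => i; rewrite -mnm_tnth.
by apply: sort_sorted => x y; rewrite /geq /=; apply: leq_total.
Qed.

Lemma perm_mnm (n : nat) (m : 'X_{1..n}) (s : 'S_n) :
  perm_eq m [multinom m (s i) | i < n].
Proof.
rewrite perm_sym; apply/tuple_permP; exists s.
by apply: eq_map => i; rewrite -mnm_tnth.
Qed.

Lemma sym_expansion_coef (n d : nat) (c : 'X_{1..n} -> rat) (k : 'X_{1..n}) :
  is_part_mnm d k ->
  (\sum_(m : 'X_{1..n < d.+1} | is_part_mnm d m) c m *: monomial_sym m)@_k
  = c k.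
Proof.
move=> /andP[/eqP dk sk]; rewrite raddf_sum /=.
have lt_k : (mdeg k < d.+1)%N by rewrite dk.
rewrite (bigD1 (BMultinom lt_k)) /=; last by rewrite /is_part_mnm dk eqxx.
rewrite mcoeffZ mcoeff_monomial_sym perm_refl mulr1 big1 ?addr0 //.
move=> m /andP[/andP[_ sm] ne]; rewrite mcoeffZ mcoeff_monomial_sym.
case: (boolP (perm_eq k m)) => [km|_]; last by rewrite mulr0.
have geq_tr : transitive geq by move=> x y z; rewrite /geq /= => h1 /leq_trans->.
have geq_as : antisymmetric geq.
  by move=> x y; rewrite /geq /= => h; apply/esym/anti_leq.
have e : k = m :> seq nat by apply: (sorted_eq geq_tr geq_as).
by case/negP: ne; apply/eqP/val_inj/val_inj/val_inj => /=.
Qed.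

Lemma sym_expansion (n d : nat) (F : {mpoly rat[n]}) :
  F \is symmetric -> F \is d.-homog ->
  F = \sum_(m : 'X_{1..n < d.+1} | is_part_mnm d m)
        sym_coef F m *: monomial_sym m.
Proof.
move=> symF homF; apply/mpolyP => k.
have coefE (m : 'X_{1..n}) : sym_coef F m = F@_m.
  by congr (_@__); apply/mnmP => i; rewrite mnmE mnm_tnth (tnth_nth 0%N).
case: (eqVneq (mdeg k) d) => [dk|ndk]; last first.
  rewrite (dhomog_nemf_coeff homF ndk) raddf_sum big1 // => m /andP[/eqP dm _].
  rewrite /= mcoeffZ mcoeff_monomial_sym; case: (boolP (perm_eq k m)) => [km|_].
    by case/eqP: ndk; rewrite -dm /mdeg; apply: perm_big.
  by rewrite mulr0.
have [s ks] := mnm_sort k; set k' := [multinom _ | _ < _] in ks.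
have kk' : perm_eq k k' := perm_mnm k s.
have dk' : mdeg k' = d by rewrite mdeg_mperm.
rewrite -(msym_coeff k s symF) -/k' -coefE.
rewrite -(@sym_expansion_coef n d (fun m => sym_coef F m) k'); last first.
  by rewrite /is_part_mnm dk' eqxx.
rewrite !raddf_sum; apply: eq_bigr => m _ /=.
by rewrite !mcoeffZ !mcoeff_monomial_sym (permPl kk').
Qed.

Lemma sym_expansion_uniq (n d : nat) (F : {mpoly rat[n]})
    (c : 'X_{1..n} -> rat) :
  F = \sum_(m : 'X_{1..n < d.+1} | is_part_mnm d m) c m *: monomial_sym m ->
  forall m : 'X_{1..n}, is_part_mnm d m -> c m = sym_coef F m.
Proof.
move=> FE m pm; rewrite /sym_coef.
have -> : mnm_of_part n m = m.
  by apply/mnmP => i; rewrite mnmE mnm_tnth (tnth_nth 0%N).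
by rewrite FE sym_expansion_coef.
Qed.

Definition Lambda (n : nat) (F : {mpoly rat[n]}) : rat :=
  let c := sym_coef F in
  96 * (c [:: 12] + c [:: 10; 2] - c [:: 9; 3] + c [:: 8; 4]
        + c [:: 8; 2; 2] - c [:: 7; 5] - c [:: 7; 3; 2] + c [:: 6; 6]
        + c [:: 5; 4; 3])
  + 32 * c [:: 4; 4; 4] + (n%:R - 3) * c [:: 3; 3; 3; 3].

Definition Q (n : nat) : rat :=
  let x : rat := n%:R in
  x ^+ 6 - 36 * x ^+ 5 + 376 * x ^+ 4 - 1920 * x ^+ 3 + 5635%:R * x ^+ 2
  - 9456%:R * x + 6912%:R.

(* Main.v *)
(* Nonnegativity.  Let G = 2H, so that H has six edges.  Lambda of the
   symmetrization is a sum, over all relabellings of H, of coefficients of the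
   square monomial supported on the first two, three or four vertices.  A
   coefficient supported on T vanishes unless T covers all edges of H, and then
   it depends only on the multiplicities inside T and on the number of edges
   leaving T at each vertex.  Pair coefficients are nonnegative.  Distributing
   each covering pair over the triples that contain it, in proportion to the
   degree of the third vertex, makes all triple contributions nonnegative (this
   uses n >= 12).  Sharing each triple among the 4-sets that contain it then
   gives a nonnegative contribution for each of the finitely many local types of
   4-sets.  The shares add up to at most 1 unless H = K_{2,3}, and in that case
   the 4-set coefficients already have a nonnegative sum.

   Discriminant.  Lambda only sees exponents with at most four parts, hence is
   unchanged when all variables but four are set to 0.  Then P becomes t^(n-4)
   times a quartic, so the coefficients of J become explicit rational multiples
   of the elementary symmetric polynomials in four variables, which are
   substituted into the discriminant of the general quartic. *)

From HB Require Import structures.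
Require Import Defs.
From Stdlib Require Import ZArith.
From mathcomp Require Import all_boot all_order all_algebra all_fingroup.
From mathcomp Require Import mpoly ssrZ zify ring lra.

Set Implicit Arguments.
Unset Strict Implicit.
Unset Printing Implicit Defensive.

Import Order.TTheory GRing.Theory Num.Theory.
Local Open Scope ring_scope.
Delimit Scope Z_scope with coqZ.

(** * Linear functionals on products of differences *)

(** All finite checks are run in the binary integers [Z], where [vm_compute] is fast; [ZtoQ] carries
    their results to [rat]. *)
Definition ZtoQ (z : Z) : rat := (int_of_Z z)%:~R.

Lemma ZtoQ0 : ZtoQ 0%coqZ = 0. Proof. by []. Qed.

Lemma ZtoQ1 : ZtoQ 1%coqZ = 1. Proof. by []. Qed.

Lemma ZtoQN a : ZtoQ (- a)%coqZ = - ZtoQ a.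
Proof. by rewrite /ZtoQ (raddfN int_of_Z a) rmorphN. Qed.

Lemma ZtoQD a b : ZtoQ (a + b)%coqZ = ZtoQ a + ZtoQ b.
Proof. by rewrite /ZtoQ (raddfD int_of_Z a b) rmorphD. Qed.

Lemma ZtoQB a b : ZtoQ (a - b)%coqZ = ZtoQ a - ZtoQ b.
Proof. by rewrite /ZtoQ (raddfB int_of_Z a b) rmorphB. Qed.

Lemma ZtoQM a b : ZtoQ (a * b)%coqZ = ZtoQ a * ZtoQ b.
Proof. by rewrite /ZtoQ (rmorphM int_of_Z a b) rmorphM. Qed.

Lemma ZtoQ_nat k : ZtoQ (Z.of_nat k) = k%:R.
Proof. by rewrite /ZtoQ -[Z.of_nat k]/(Z_of_int k) Z_of_intK. Qed.

Lemma ZtoQ_ge0 a : (0 <=? a)%coqZ -> 0 <= ZtoQ a.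
Proof. by case: a => // p _; rewrite /ZtoQ ler0z. Qed.

Fixpoint binrow_aux (c : Z) (s : seq Z) : seq Z :=
  if s is a :: s' then (a - c)%coqZ :: binrow_aux a s' else [:: (- c)%coqZ].

(* Coefficients of (x - y)^N by decreasing powers of x. *)
Fixpoint binrow (N : nat) : seq Z :=
  if N is N'.+1 then binrow_aux 0 (binrow N') else [:: 1%coqZ].

Fixpoint binsum_aux (s : seq Z) (a b : nat) (f : nat -> nat -> Z) : Z :=
  if s is c :: s' then (c * f a b + binsum_aux s' a.-1 b.+1 f)%coqZ else 0%coqZ.

Definition binsum (N : nat) (f : nat -> nat -> Z) : Z :=
  binsum_aux (binrow N) N 0 f.

Lemma size_binrow_aux c s : size (binrow_aux c s) = (size s).+1.
Proof. by elim: s c => //= a s IH c; rewrite IH. Qed.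

Lemma size_binrow N : size (binrow N) = N.+1.
Proof. by elim: N => //= N IH; rewrite size_binrow_aux IH. Qed.

Lemma nth_binrow_aux c s k : (k <= size s)%N ->
  nth 0%coqZ (binrow_aux c s) k = (nth 0%coqZ s k - nth 0%coqZ (c :: s) k)%coqZ.
Proof.
elim: s c k => [|a s IH] c [|k] //=.
by rewrite ltnS => /IH ->.
Qed.

Lemma nth_binrow N k : (k <= N)%N ->
  ZtoQ (nth 0%coqZ (binrow N) k) = (-1) ^+ k * ('C(N, k))%:R.
Proof.
elim: N k => [|N IH] k; first by case: k => //= _; rewrite ZtoQ1 expr0 mul1r.
move=> le_kN /=; rewrite nth_binrow_aux; last by rewrite size_binrow.
rewrite ZtoQB; case: k le_kN => [_|k le_kN].
  by rewrite /= ZtoQ0 subr0 IH // !bin0.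
rewrite [nth _ (_ :: _) _]/= (IH k) // binS natrD mulrDr.
have [lt_kN|] := ltnP k N; first by rewrite IH // exprS mulN1r !mulNr.
(* For [k = N] the row is read one place past its end; the default 0 agrees with the binomial
   coefficient C(N, N+1). *)
rewrite leq_eqVlt ltnNge -ltnS le_kN orbF => /eqP->.
rewrite nth_default ?size_binrow // ZtoQ0 (bin_small (ltnSn k)) mulr0 !add0r
  exprS.
by rewrite mulN1r mulNr.
Qed.

Lemma binsum_auxE s a b f : (size s <= a.+1)%N ->
  ZtoQ (binsum_aux s a b f) =
  \sum_(k < size s) ZtoQ (nth 0%coqZ s k) * ZtoQ (f (a - k)%N (b + k)%N).
Proof.
elim: s a b => [|c s IH] a b; first by rewrite big_ord0.
rewrite /= big_ord_recl ZtoQD ZtoQM /= subn0 addn0 => le_sa; congr (_ + _).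
case: a le_sa => [|a] le_sa.
  by case: s IH le_sa => [|? ?] IH //; rewrite big_ord0.
rewrite IH //=; apply: eq_bigr => i _.
by rewrite /bump leq0n add1n subSS addSnnS.
Qed.

(** Binomial expansion under [L]. Additivity of [L] is enough, because the coefficients are signed
    natural numbers. *)
Lemma binsumP (R : comNzRingType) (L : {additive R -> rat}) (P x y : R) N f :
    (forall a b, (a + b)%N = N ->
       L (P * x ^+ a * y ^+ b) = ZtoQ (f a b)) ->
  L (P * (x - y) ^+ N) = ZtoQ (binsum N f).
Proof.
move=> HL; rewrite exprBn mulr_sumr raddf_sum /binsum.
rewrite binsum_auxE ?size_binrow //; apply: eq_bigr => k _.
have le_kN : (k <= N)%N by rewrite -ltnS.
rewrite nth_binrow // add0n -HL ?subnK //.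
rewrite [in LHS]mulrnAr raddfMn /= -!mulrA mulrCA.
have -> (z : R) : L ((-1) ^+ k * z) = (-1) ^+ k * L z.
  rewrite -(signr_odd R k) -(signr_odd rat k).
  by case: (odd k); rewrite ?expr0 ?expr1 ?mul1r ?mulN1r ?raddfN.
by rewrite mulr_natl mulrnAr.
Qed.

(* [edge_eval w E e] is the value at x^e * \prod_((i, j, N) in E) (x_i - x_j)^N
   of the linear functional with value [w f] at x^f. *)
Fixpoint edge_eval (w : seq nat -> Z) (E : seq (nat * nat * nat)) (e : seq nat)
    : Z :=
  if E is (i, j, N) :: E' then
    binsum N (fun a b =>
      edge_eval w E' (set_nth 0%N (set_nth 0%N e i (nth 0%N e i + a)%N) j
                       (nth 0%N (set_nth 0%N e i (nth 0%N e i + a)%N) j + b)%N))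
  else w e.

Definition edge_ok (K : nat) (t : nat * nat * nat) : bool :=
  (t.1.1 < K)%N && (t.1.2 < K)%N.

(** * Coefficients supported on the first [K] variables *)

Section Variables.

Variable N : nat.
Notation n := N.+1.

Definition var (k : nat) : {mpoly rat[n]} := 'X_(inord k).

Definition xpow (e : seq nat) : {mpoly rat[n]} := 'X_[mnm_of_part n e].

Lemma xpow_incr K e i a : (K <= n)%N -> size e = K -> (i < K)%N ->
  xpow e * var i ^+ a = xpow (set_nth 0%N e i (nth 0%N e i + a)%N).
Proof.
move=> le_Kn sz_e lt_iK; rewrite /xpow /var mpolyXn -mpolyXD; congr 'X_[_].
apply/mnmP => j; rewrite mnmDE mulmnE mnm1E !mnmE nth_set_nth /=.
have <- : (inord i == j) = (j == i :> nat).
  apply/eqP/eqP => [<-|<-]; first by rewrite inordK // (leq_trans lt_iK).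
  by rewrite inord_val.
case: eqP => [<-|_]; last by rewrite addn0.
by rewrite mul1n inordK // (leq_trans lt_iK).
Qed.

(** The factors are expanded one at a time and [e] accumulates the exponents, so that the polynomial
    itself is never built and [L] is evaluated on monomials only. *)
Lemma edge_evalP K (L : {additive {mpoly rat[n]} -> rat}) w E e :
    (K <= n)%N -> size e = K -> all (edge_ok K) E ->
    (forall e', size e' = K -> L (xpow e') = ZtoQ (w e')) ->
  L (xpow e * \prod_(t <- E) (var t.1.1 - var t.1.2) ^+ t.2) =
  ZtoQ (edge_eval w E e).
Proof.
move=> le_Kn; elim: E e => [|[[i j] M] E IH] e sz_e /=.
  by move=> _ HL; rewrite big_nil mulr1 HL.
move=> /andP[/andP[/= lt_iK lt_jK] okE] HL.
rewrite big_cons /= mulrCA mulrC; apply: binsumP => a b _.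
rewrite -mulrA mulrAC mulrA (xpow_incr _ _ sz_e) //.
have sz1 : size (set_nth 0%N e i (nth 0%N e i + a)) = K.
  by rewrite size_set_nth sz_e; apply/maxn_idPr.
rewrite (xpow_incr _ _ sz1) //; apply: IH => //.
by rewrite size_set_nth sz1; apply/maxn_idPr.
Qed.

(* Setting x_i to 0 for i >= K keeps the coefficients supported on the first K
   variables. *)
Definition trunc (K : nat) (p : {mpoly rat[n]}) : {mpoly rat[n]} :=
  p \mPo [tuple (if (i < K)%N then 'X_i else 0) | i < n].

HB.instance Definition _ K :=
  GRing.RMorphism.copy (trunc K)
    (comp_mpoly [tuple (if (i < K)%N then 'X_i else 0) | i < n]).

Lemma trunc_var K k : (k < n)%N ->
  trunc K (var k) = if (k < K)%N then var k else 0.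
Proof.
move=> lt_kn; rewrite /trunc /var comp_mpolyXU -tnth_nth tnth_mktuple.
by rewrite inordK.
Qed.

(** By linearity only monomials matter: one involving a variable of index at least [K] is sent to 0
    and differs from [x^m], any other is fixed. *)
Lemma trunc_coef K (p : {mpoly rat[n]}) (m : 'X_{1..n}) :
  (forall i : 'I_n, (K <= i)%N -> m i = 0%N) -> (trunc K p)@_m = p@_m.
Proof.
move=> m0.
suff trX k : (trunc K 'X_[k])@_m = ('X_[k] : {mpoly rat[n]})@_m.
  rewrite (mpolyE p) (raddf_sum (trunc K)) /= !(raddf_sum (mcoeff m)) /=.
  apply: eq_bigr => k _.
  by rewrite [trunc _ _]comp_mpolyZ !mcoeffZ -trX.
rewrite /trunc comp_mpolyX.
have [/existsP[i /andP[le_Ki k_neq0]]|] :=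
  boolP [exists i : 'I_n, (K <= i)%N && (k i != 0%N)].
  rewrite (bigD1 i) //= tnth_mktuple ltnNge le_Ki /= expr0n (negPf k_neq0).
  rewrite mul0r mcoeff0 mcoeffX; case: eqP => // km.
  by rewrite km m0 // eqxx in k_neq0.
rewrite negb_exists => /forallP kK; congr (_@__).
rewrite [RHS]mpolyXE_id; apply: eq_bigr => i _; rewrite tnth_mktuple.
case: ltnP => // le_Ki; have := kK i; rewrite le_Ki negbK => /eqP->.
by rewrite !expr0.
Qed.

End Variables.

(** * Coefficient tables evaluated on square graph monomials *)

Definition coef_table := seq (Z * seq nat).

Definition table_weight (tab : coef_table) (e : seq nat) : Z :=
  foldr (fun t z => if t.2 == e then (t.1 + z)%coqZ else z) 0%coqZ tab.

Definition edges (K : nat) (h : nat -> nat -> nat) : seq (nat * nat * nat) :=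
  [seq (i, j, (2 * h i j)%N) | i <- index_iota 0 K, j <- index_iota i.+1 K].

(** Edges leaving the vertex set enter only through the initial exponents [2 * p i]. *)
Definition table_eval (tab : coef_table) K (p : nat -> nat)
    (h : nat -> nat -> nat) : Z :=
  edge_eval (table_weight tab) (edges K h)
    [seq (2 * p i)%N | i <- index_iota 0 K].

Lemma edges_ok K h : all (edge_ok K) (edges K h).
Proof.
apply/allP => t /allpairsPdep[i [j [iK jK ->]]]; rewrite /edge_ok /=.
by move: iK jK; rewrite !mem_index_iota /=; lia.
Qed.

Section SplitTriangle.

Variables (T : Type) (idx : T) (op : Monoid.com_law idx).

(** With T the set of the first [K] vertices, the three factors range over the pairs inside T,
    leaving T and missing T. *)
Lemma big_triangle_split K n (f : nat -> nat -> T) : (K <= n)%N ->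
  \big[op/idx]_(0 <= i < n) \big[op/idx]_(i.+1 <= j < n) f i j =
  op (op (\big[op/idx]_(0 <= i < K) \big[op/idx]_(i.+1 <= j < K) f i j)
         (\big[op/idx]_(0 <= i < K) \big[op/idx]_(K <= j < n) f i j))
     (\big[op/idx]_(K <= i < n) \big[op/idx]_(i.+1 <= j < n) f i j).
Proof.
move=> le_Kn; rewrite (@big_cat_nat _ _ _ K) //=; congr (op _ _).
rewrite -big_split /=; apply: eq_big_nat => i /andP[_ lt_iK].
by rewrite (@big_cat_nat _ _ _ K).
Qed.

End SplitTriangle.

Section GraphMonomial.

Variable N : nat.
Notation n := N.+1.
Notation graph := ('I_n -> 'I_n -> nat).

Definition table_coef (tab : coef_table) (p : {mpoly rat[n]}) : rat :=
  \sum_(t <- tab) ZtoQ t.1 * p@_(mnm_of_part n t.2).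

Lemma table_coef_is_additive tab : additive (table_coef tab).
Proof.
move=> p q; rewrite /table_coef -sumrB; apply: eq_bigr => t _.
by rewrite mcoeffB mulrBr.
Qed.

HB.instance Definition _ tab :=
  GRing.isAdditive.Build _ _ (table_coef tab) (table_coef_is_additive tab).

Lemma mnm_of_part_eq K (e f : seq nat) : (K <= n)%N -> size e = K ->
  size f = K -> (mnm_of_part n e == mnm_of_part n f) = (e == f).
Proof.
move=> le_Kn sz_e sz_f; apply/eqP/eqP => [/mnmP ef|-> //].
apply: (@eq_from_nth _ 0%N) => [|i]; first by rewrite sz_f.
rewrite sz_e => lt_iK; have := ef (inord i); rewrite !mnmE inordK //.
exact: leq_trans lt_iK _.
Qed.

Lemma table_coef_xpow tab K e : (K <= n)%N -> size e = K ->
    all (fun t => size t.2 == K) tab ->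
  table_coef tab (xpow N e) = ZtoQ (table_weight tab e).
Proof.
move=> le_Kn sz_e; rewrite /table_coef.
elim: tab => [|t tab IH]; first by rewrite big_nil.
move=> /= /andP[/eqP sz_t sz_tab]; rewrite big_cons IH // mcoeffX.
rewrite (mnm_of_part_eq le_Kn) // eq_sym; case: ifP => _.
  by rewrite mulr1 ZtoQD.
by rewrite mulr0 add0r.
Qed.

Lemma table_coef_trunc tab K p :
    all (fun t => size t.2 == K) tab ->
  table_coef tab (trunc K p) = table_coef tab p.
Proof.
rewrite /table_coef => /allP sz_tab; rewrite !big_seq.
apply: eq_bigr => t /sz_tab/eqP sz_t; congr (_ * _).
by apply: trunc_coef => i le_Ki; rewrite mnmE nth_default // sz_t.
Qed.

Definition square_monomial (h : graph) : {mpoly rat[n]} :=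
  \prod_(i < n) \prod_(j < n | (i < j)%N) ('X_i - 'X_j) ^+ (2 * h i j).

Definition edge_count (h : graph) : nat :=
  (\sum_(i < n) \sum_(j < n | (i < j)%N) h i j)%N.

Definition natg (h : graph) (i j : nat) : nat := h (inord i) (inord j).

(* For T = {0, ..., K-1}, [leaving K h i] counts the edges from i to the outside
   of T and [uncovered K h] the edges that miss T. *)
Definition leaving K (h : graph) (i : nat) : nat :=
  (\sum_(K <= j < n) natg h i j)%N.

Definition uncovered K (h : graph) : nat :=
  (\sum_(K <= i < n) \sum_(i.+1 <= j < n) natg h i j)%N.

Lemma big_triangle (T : Type) (idx : T) (op : Monoid.com_law idx)
    (f : nat -> nat -> T) :
  \big[op/idx]_(i < n) \big[op/idx]_(j < n | (i < j)%N) f i j =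
  \big[op/idx]_(0 <= i < n) \big[op/idx]_(i.+1 <= j < n) f i j.
Proof.
rewrite big_mkord; apply: eq_bigr => i _.
by rewrite (big_nat_widenl _ 0) // big_mkord.
Qed.

Lemma square_monomial_nat h : square_monomial h =
  \prod_(0 <= i < n) \prod_(i.+1 <= j < n)
    (var N i - var N j) ^+ (2 * natg h i j).
Proof.
rewrite -(big_triangle _ (fun i j => (var N i - var N j) ^+ (2 * natg h i j))).
apply: eq_bigr => i _; apply: eq_bigr => j _.
by rewrite /var /natg !inord_val.
Qed.

Lemma edge_count_nat h : edge_count h =
  (\sum_(0 <= i < n) \sum_(i.+1 <= j < n) natg h i j)%N.
Proof.
rewrite -(big_triangle _ (natg h)).
apply: eq_bigr => i _; apply: eq_bigr => j _.
by rewrite /natg !inord_val.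
Qed.

Lemma edge_count_split K h : (K <= n)%N -> edge_count h =
  (\sum_(0 <= i < K) \sum_(i.+1 <= j < K) natg h i j
   + \sum_(0 <= i < K) leaving K h i + uncovered K h)%N.
Proof. by move=> le_Kn;
  rewrite edge_count_nat (big_triangle_split _ _ le_Kn). Qed.

Lemma xpowE K (p : nat -> nat) : (K <= n)%N ->
  xpow N [seq p i | i <- index_iota 0 K] = \prod_(0 <= i < K) var N i ^+ p i.
Proof.
move=> le_Kn; rewrite /xpow mpolyXE_id.
transitivity (\prod_(i < n) (fun k => var N k ^+
    nth 0%N [seq p i | i <- index_iota 0 K] k) i).
  by apply: eq_bigr => i _; rewrite mnmE /var /= inord_val.
rewrite -(big_mkord xpredT (fun k => var N k ^+
    nth 0%N [seq p i | i <- index_iota 0 K] k)) (@big_cat_nat _ _ _ K) //=.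
rewrite [X in _ * X]big1_seq ?mulr1 => [|i]; last first.
  case/andP=> _; rewrite mem_index_iota => /andP[le_Ki _].
  by rewrite nth_default ?expr0 // size_map size_iota subn0.
apply: eq_big_nat => i /andP[_ lt_iK].
by rewrite (nth_map 0%N) ?size_iota ?subn0 // nth_iota ?subn0 // add0n.
Qed.

(** Once the variables outside T vanish, a pair inside T is unchanged, a pair leaving T at [i]
    contributes a power of x_i, and a pair missing T gives a power of 0, which is 1 for multiplicity
    0 and 0 otherwise. *)
Lemma trunc_square_monomial K h : (K <= n)%N -> trunc K (square_monomial h) =
  if uncovered K h == 0%N then
    xpow N [seq (2 * leaving K h i)%N | i <- index_iota 0 K]
    * \prod_(t <- edges K (natg h)) (var N t.1.1 - var N t.1.2) ^+ t.2
  else 0.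
Proof.
move=> le_Kn; rewrite square_monomial_nat (big_triangle_split _ _ le_Kn)
  !rmorphM /=.
have -> : trunc K (\prod_(K <= i < n) \prod_(i.+1 <= j < n)
      (var N i - var N j) ^+ (2 * natg h i j)) = (uncovered K h == 0%N)%:R.
  transitivity (\prod_(K <= i < n) \prod_(i.+1 <= j < n)
     ((natg h i j == 0%N)%:R : {mpoly rat[n]})).
    rewrite rmorph_prod; apply: eq_big_nat => i /andP[le_Ki lt_in].
    rewrite rmorph_prod; apply: eq_big_nat => j /andP[lt_ij lt_jn].
    rewrite /= rmorphXn rmorphB /= !trunc_var // !ltnNge le_Ki.
    by rewrite (leq_trans le_Ki (ltnW lt_ij)) subrr expr0n muln_eq0.
  have and01 (a b : bool) : a%:R * b%:R = (a && b)%:R :> {mpoly rat[n]}.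
    by case: a; rewrite ?mul1r ?mul0r.
  have sum0 m (f : nat -> nat) : \prod_(m <= i < n) (f i == 0%N)%:R
      = (\sum_(m <= i < n) f i == 0)%N%:R :> {mpoly rat[n]}.
    elim/big_rec2: _ => // i y x _ ->; rewrite and01 addn_eq0 andbC.
    by rewrite andbC.
  rewrite -sum0; apply: eq_bigr => i _; exact: sum0.
case: eqP => _; last by rewrite mulr0.
rewrite mulr1 mulrC; congr (_ * _).
  rewrite xpowE // rmorph_prod; apply: eq_big_nat => i /andP[_ lt_iK].
  rewrite rmorph_prod /leaving big_distrr /= -prodrXr.
  apply: eq_big_nat => j /andP[le_Kj lt_jn].
  rewrite /= rmorphXn rmorphB /= !trunc_var ?lt_iK //; last first.
    exact: leq_trans lt_iK _.
  by rewrite ltnNge le_Kj subr0.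
rewrite /edges big_allpairs_dep rmorph_prod.
apply: eq_big_nat => i /andP[_ lt_iK]; rewrite rmorph_prod.
apply: eq_big_nat => j /andP[lt_ij lt_jK] /=.
have [lt_in lt_jn] : (i < n)%N /\ (j < n)%N.
  by split; [apply: leq_trans lt_iK _ | apply: leq_trans lt_jK _].
by rewrite rmorphXn rmorphB /= !trunc_var // lt_iK lt_jK.
Qed.

Lemma table_coef_square_monomial tab K h : (K <= n)%N ->
    all (fun t => size t.2 == K) tab ->
  table_coef tab (square_monomial h) =
  if uncovered K h == 0%N then ZtoQ (table_eval tab K (leaving K h) (natg h))
    else 0.
Proof.
move=> le_Kn sz_tab; rewrite -(table_coef_trunc _ sz_tab)
  trunc_square_monomial //.
case: ifP => _; last by rewrite raddf0.
apply: (edge_evalP le_Kn) => [||e sz_e];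
  first by rewrite size_map size_iota subn0.
  exact: edges_ok.
exact: (table_coef_xpow le_Kn sz_e sz_tab).
Qed.

End GraphMonomial.

(** * Relabelling graphs *)

Lemma orientation_ltn n : orientation (fun i j : 'I_n => (i < j)%N).
Proof. by move=> i j; rewrite neq_ltn => /orP[] /= lt_ij; lia. Qed.

(** The pairs on which the orientations agree occur on both sides; the others are matched by
    exchanging [i] and [j], which [F] does not notice. *)
Lemma big_orientation (T : Type) (idx : T) (op : Monoid.com_law idx) n
    (o1 o2 : rel 'I_n) (F : 'I_n -> 'I_n -> T) :
    orientation o1 -> orientation o2 ->
    (forall i j, F i j = F j i) -> (forall i, F i i = idx) ->
  \big[op/idx]_(i < n) \big[op/idx]_(j < n | o1 i j) F i j =
  \big[op/idx]_(i < n) \big[op/idx]_(j < n | o2 i j) F i j.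
Proof.
move=> o1P o2P symF F1; rewrite !pair_big_dep /=.
rewrite (bigID (fun p => o2 p.1 p.2)) [RHS](bigID (fun p => o1 p.1 p.2)) /=.
congr (op _ _); first by apply: eq_bigl => p; rewrite andbC.
rewrite (reindex_inj (h := fun p => (p.2, p.1))) /=; last first.
  by move=> [? ?] [? ?] [-> ->].
rewrite big_mkcond [RHS]big_mkcond /=; apply: eq_bigr => -[i j] _ /=.
have [->|ne_ij] := eqVneq i j; first by rewrite F1 !if_same.
have ne_ji : j != i by rewrite eq_sym.
by rewrite (o1P _ _ ne_ij) (o2P _ _ ne_ij) negbK andbC symF.
Qed.

Section Symmetrize.

Variable N : nat.
Notation n := N.+1.
Notation graph := ('I_n -> 'I_n -> nat).
Implicit Types (h : graph) (s : 'S_n).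

Definition simple_graph h : Prop :=
  (forall i j, h i j = h j i) /\ (forall i, h i i = 0%N).

Definition relabel h s : graph := fun i j => h (s i) (s j).

Lemma simple_relabel h s : simple_graph h -> simple_graph (relabel h s).
Proof. by case=> h_sym h0; split=> *; [apply: h_sym | apply: h0]. Qed.

Lemma natg_sym h i j : simple_graph h -> natg h i j = natg h j i.
Proof. by case=> h_sym _; apply: h_sym. Qed.

Lemma square_monomial_orient h (o : rel 'I_n) : simple_graph h -> orientation
  o ->
  square_monomial h = \prod_(i < n) \prod_(j < n | o i j) ('X_i - 'X_j) ^+ (2
    * h i j).
Proof.
case=> h_sym h0 oP; apply: big_orientation => // [|i j|i].
- exact: orientation_ltn.
- by rewrite h_sym !exprM -sqrrN opprB.
- by rewrite h0 muln0.
Qed.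

Lemma relabel_orient s (o : rel 'I_n) : orientation o ->
  orientation (fun i j => o (s i) (s j)).
Proof. by move=> oP i j ne_ij; apply: oP; rewrite (inj_eq perm_inj). Qed.

Lemma edge_count_relabel h s : simple_graph h -> edge_count (relabel h s) =
  edge_count h.
Proof.
case=> h_sym h0; pose o := fun i j : 'I_n => ((s^-1)%g i < (s^-1)%g j)%N.
rewrite [RHS](@big_orientation _ _ _ _ _ o) //; last first.
- exact: (relabel_orient (o := fun i j : 'I_n
  => (i < j)%N) _ (@orientation_ltn n)).
- exact: orientation_ltn.
rewrite [RHS](reindex_inj (@perm_inj _ s)); apply: eq_bigr => i _.
rewrite [RHS](reindex_inj (@perm_inj _ s)); apply: eq_bigl => j.
by rewrite /o !permK.
Qed.

(** Renaming x_i to x_(s i) moves the factor of {i, j} to {s i, s j}, hence the inverse. The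
    orientation [o] is the natural order transported by [s], which makes both products match factor
    by factor. *)
Lemma msym_square_monomial h s : simple_graph h -> msym s (square_monomial h)
  = square_monomial (relabel h s^-1).
Proof.
move=> hP; pose o := fun i j : 'I_n => ((s^-1)%g i < (s^-1)%g j)%N.
have oP : orientation o.
  exact: (relabel_orient (o := fun i j : 'I_n
    => (i < j)%N) _ (@orientation_ltn n)).
rewrite (square_monomial_orient (simple_relabel s^-1 hP) oP) /square_monomial
  rmorph_prod.
rewrite [RHS](reindex_inj (@perm_inj _ s)); apply: eq_bigr => i _.
rewrite rmorph_prod [RHS](reindex_inj (@perm_inj _ s)) /=.
apply: eq_big => j; first by rewrite /o !permK.
move=> _; rewrite rmorphXn rmorphB /= /relabel !permK; congr ((_ - _) ^+ _).
  by rewrite /msym mmapX mmap1U.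
by rewrite /msym mmapX mmap1U.
Qed.

Lemma symmetrization_square_monomial h : simple_graph h ->
  symmetrization (square_monomial h) = \sum_s square_monomial (relabel h s).
Proof.
move=> hP; rewrite [RHS](reindex_inj invg_inj).
by apply: eq_bigr => s _; apply: msym_square_monomial.
Qed.

Lemma relabel_mul h s t i j : relabel (relabel h s) t i j = relabel h (t *
  s)%g i j.
Proof. by rewrite /relabel !permM. Qed.

Lemma eq_square_monomial h1 h2 : h1 =2 h2 -> square_monomial h1 =
  square_monomial h2.
Proof.
by move=> eqh; apply: eq_bigr => i _; apply: eq_bigr => j _; rewrite eqh.
Qed.

(** Translation by [t] permutes the relabellings. Graphs are functions compared pointwise, so [f] is
    asked to respect [=2]. *)
Lemma sum_relabel (f : graph -> rat) h t : (forall h1 h2, h1 =2 h2 -> f h1 = f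
  h2) ->
  \sum_s f (relabel (relabel h s) t) = \sum_s f (relabel h s).
Proof.
move=> eqf; rewrite [RHS](reindex_inj (mulgI t)).
by apply: eq_bigr => s _; apply: eqf => i j; rewrite relabel_mul.
Qed.

Lemma mono_act_coef h s (m : 'X_{1..n}) : simple_graph h ->
  (square_monomial (relabel h s))@_m = (square_monomial h)@_[multinom m
    ((s^-1)%g i) | i < n].
Proof. by move=> hP; rewrite -[in LHS](invgK s) -msym_square_monomial //
  mcoeff_sym. Qed.

Lemma table_coef_relabel tab h s : simple_graph h ->
    (forall t i, t \in tab -> nth 0%N t.2 (s i) = nth 0%N t.2 i) ->
  table_coef tab (square_monomial (relabel h s)) = table_coef tab
    (square_monomial h).
Proof.
move=> hP fix_s; rewrite /table_coef !big_seq; apply: eq_bigr => t t_tab.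
rewrite mono_act_coef //; congr (_ * _@__); apply/mnmP => i.
by rewrite !mnmE -(fix_s _ ((s^-1)%g i)) // permKV.
Qed.

End Symmetrize.

Lemma graph_monomial_square N (G : multigraph N.+1) (o : rel 'I_N.+1) :
    orientation o -> square_graph G ->
  graph_monomial G o = square_monomial (fun i j => (mult G i j)./2).
Proof.
move=> oP sqG; rewrite (square_monomial_orient _ oP).
  apply: eq_bigr => i _; apply: eq_bigr => j _; congr (_ ^+ _).
  by have := sqG i j; have := odd_double_half (mult G i j); lia.
by split=> [i j|i]; rewrite ?(mult_sym G i j) ?mult_loopless.
Qed.

Lemma graph_degree_count N (G : multigraph N.+1) : square_graph G ->
  graph_degree G = (2 * edge_count (fun i j => (mult G i j)./2))%N.
Proof.
move=> sqG; rewrite /graph_degree /edge_count big_distrr /=.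
apply: eq_bigr => i _; rewrite big_distrr /=; apply: eq_bigr => j _.
by have := sqG i j; have := odd_double_half (mult G i j); lia.
Qed.

(** * Local inequalities on pairs, triples and 4-sets *)

Local Open Scope Z_scope.

(* On symmetric polynomials, Lambda is
   16 (3 * pair_table + triple_table) + (n - 3) * quad_table. *)
Definition pair_table : coef_table :=
  [:: (1, [:: 12; 0]%N); (1, [:: 0; 12]%N); (1, [:: 10; 2]%N); (1, [:: 2;
    10]%N);
      (-1, [:: 9; 3]%N); (-1, [:: 3; 9]%N); (1, [:: 8; 4]%N); (1, [:: 4; 8]%N);
      (-1, [:: 7; 5]%N); (-1, [:: 5; 7]%N); (2, [:: 6; 6]%N)].

Definition triple_table : coef_table :=
  [:: (2, [:: 8; 2; 2]%N); (2, [:: 2; 8; 2]%N); (2, [:: 2; 2; 8]%N);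
      (-1, [:: 7; 3; 2]%N); (-1, [:: 7; 2; 3]%N); (-1, [:: 3; 7; 2]%N);
      (-1, [:: 2; 7; 3]%N); (-1, [:: 3; 2; 7]%N); (-1, [:: 2; 3; 7]%N);
      (1, [:: 5; 4; 3]%N); (1, [:: 5; 3; 4]%N); (1, [:: 4; 5; 3]%N);
      (1, [:: 3; 5; 4]%N); (1, [:: 4; 3; 5]%N); (1, [:: 3; 4; 5]%N);
      (2, [:: 4; 4; 4]%N)].

Definition quad_table : coef_table := [:: (1, [:: 3; 3; 3; 3]%N)].

Definition pair_value (p0 p1 h01 : nat) : Z :=
  edge_eval (table_weight pair_table) [:: (0, 1, 2 * h01)]%N [:: 2 * p0;
    2 * p1]%N.

Definition triple_value (p0 p1 p2 h01 h02 h12 : nat) : Z :=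
  edge_eval (table_weight triple_table)
    [:: (0, 1, 2 * h01); (0, 2, 2 * h02); (1, 2, 2 * h12)]%N
    [:: 2 * p0; 2 * p1; 2 * p2]%N.

Definition quad_value (p0 p1 p2 p3 h01 h02 h03 h12 h13 h23 : nat) : Z :=
  edge_eval (table_weight quad_table)
    [:: (0, 1, 2 * h01); (0, 2, 2 * h02); (0, 3, 2 * h03);
        (1, 2, 2 * h12); (1, 3, 2 * h13); (2, 3, 2 * h23)]%N
    [:: 2 * p0; 2 * p1; 2 * p2; 2 * p3]%N.

(* The factor 5 is 3 * 10 / 6: a covering pair has at most 6 edge ends outside
   it, and there are n - 2 >= 10 positions for a third vertex. *)
Definition spread_value (p0 p1 p2 h01 h02 h12 : nat) : Z :=
  3 * triple_value p0 p1 p2 h01 h02 h12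
  + 5 * ((if p2 is O then Z.of_nat (h02 + h12) * pair_value (h02 + p0) (h12 +
    p1) h01 else 0)
       + (if p1 is O then Z.of_nat (h01 + h12) * pair_value (h01 + p0) (h12 +
         p2) h02 else 0)
       + (if p0 is O then Z.of_nat (h02 + h01) * pair_value (h02 + p2) (h01 +
         p1) h12 else 0)).

(* Twice the fraction of a covering triple T that is given to the 4-set T + v,
   when v has [d0], [d1], [d2] edges to T and [P] other edges leave T.  The
   case of three single edges with P = 3 is forced: for the spider with three
   legs of length 2, Lambda vanishes. *)
Definition share (d0 d1 d2 P : nat) : nat :=
  let d := (d0 + d1 + d2)%N in
  (if (P < d)%N then 2
   else if P == d then
     if d == 2 then 1 else if [&& d0 == 1, d1 == 1 & d2 == 1] then 2 else 0
   else 0)%N.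

(** In a covering 4-set, the triple obtained by dropping the last vertex covers all edges exactly
    when [p3] is 0. *)
Definition shared_value (p0 p1 p2 p3 d0 d1 d2 h01 h02 h12 : nat) : Z :=
  if p3 is O then
    Z.of_nat (share d0 d1 d2 (p0 + p1 + p2))
    * spread_value (d0 + p0) (d1 + p1) (d2 + p2) h01 h02 h12
  else 0.

(** The four terms come from the four triples in the 4-set. With y, v, w, c the sums of shared,
    spread, base and 4-set coefficients, the factors 2 and 3 lead to 8y + 3c >= 0, which combines
    with (n-3)y <= 2v <= 6w into 16w + (n-3)c >= 0. *)
Definition local_check (p0 p1 p2 p3 h01 h02 h03 h12 h13 h23 : nat) : bool :=
  let c := quad_value p0 p1 p2 p3 h01 h02 h03 h12 h13 h23 in
  if 0 <=? c then true else
  0 <=? 2 * (shared_value p0 p1 p2 p3 h03 h13 h23 h01 h02 h12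
            + shared_value p0 p1 p3 p2 h02 h12 h23 h01 h03 h13
            + shared_value p0 p3 p2 p1 h01 h13 h12 h03 h02 h23
            + shared_value p3 p1 p2 p0 h03 h01 h02 h13 h23 h12) + 3 * c.

Fixpoint compositions (k s : nat) : seq (seq nat) :=
  if k is k'.+1 then
    [seq a :: l | a <- iota 0 s.+1, l <- compositions k' (s - a)%N]
  else if s is O then [:: [::]] else [::].

Lemma mem_compositions l : l \in compositions (size l) (sumn l).
Proof.
elim: l => // a l IH; apply/allpairsPdep; exists a, l; split=> //.
  by rewrite mem_iota add0n ltnS /= leq_addr.
by rewrite [sumn _]/= addKn.
Qed.

(** The edges inside a covering set and those leaving it number six in all, so its local types are
    the compositions of 6, and this bound and the next two are finite computations. *)
Lemma check_pair_value : all (fun c => if c is [:: p0; p1;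
  h01] then 0 <=? pair_value p0 p1 h01
  else true) (compositions 3 6).
Proof. by vm_compute. Qed.

Lemma check_spread_value : all (fun c => if c is [:: p0; p1; p2; h01; h02;
  h12] then
  0 <=? spread_value p0 p1 p2 h01 h02 h12 else true) (compositions 6 6).
Proof. by vm_compute. Qed.

Lemma check_local : all (fun c =>
  if c is [:: p0; p1; p2; p3; h01; h02; h03; h12; h13; h23] then
  local_check p0 p1 p2 p3 h01 h02 h03 h12 h13 h23 else true) (compositions 10
    6).
Proof. by vm_compute. Qed.


Lemma check_compositions (k s : nat) (P : pred (seq nat)) l :
  all P (compositions k s) -> size l = k -> sumn l = s -> P l.
Proof.
by move=> allC sz_l sum_l; apply: (allP allC);
  rewrite -sz_l -sum_l mem_compositions.
Qed.

Lemma pair_value_ge0 p0 p1 h01 : (p0 + p1 + h01 = 6)%N -> 0 <=? pair_value p0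
  p1 h01.
Proof.
move=> sum6; apply: (check_compositions (l := [:: p0; p1;
  h01]) check_pair_value) => //=.
by rewrite addn0 addnA.
Qed.

Lemma spread_value_ge0 p0 p1 p2 h01 h02 h12 : (p0 + p1 + p2 + (h01 + h02 +
  h12) = 6)%N ->
  0 <=? spread_value p0 p1 p2 h01 h02 h12.
Proof.
move=> sum6; apply: (check_compositions (l := [:: p0; p1; p2; h01; h02; h12])
  check_spread_value) => //=; lia.
Qed.

Lemma local_checkT p0 p1 p2 p3 h01 h02 h03 h12 h13 h23 :
    (p0 + p1 + p2 + p3 + (h01 + h02 + h03 + h12 + h13 + h23) = 6)%N ->
  local_check p0 p1 p2 p3 h01 h02 h03 h12 h13 h23.
Proof.
move=> sum6; apply: (check_compositions
  (l := [:: p0; p1; p2; p3; h01; h02; h03; h12; h13; h23]) check_local) => //=.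
lia.
Qed.

Close Scope Z_scope.

(** A triple T gives away at most its whole value: [j] runs over the vertices outside T, [d j]
    counts the edges from [j] to T, and the second hypothesis excludes K_{2,3}. *)
Lemma share_sum_le2 (r : seq nat) (f0 f1 f2 : nat -> nat)
    (d := fun j => (f0 j + f1 j + f2 j)%N) (S := (\sum_(j <- r) d j)%N) :
    uniq r ->
    (forall j k, j \in r -> k \in r -> j != k ->
       [&& f0 j == 1, f1 j == 1 & f2 j == 1]%N ->
       ~~ [&& f0 k == 1, f1 k == 1 & f2 k == 1]%N) ->
  (\sum_(j <- r) share (f0 j) (f1 j) (f2 j) (S - d j) <= 2)%N.
Proof.
move=> uniq_r noK.
have omega_le2 a b c P : (share a b c P <= 2)%N by rewrite /share;
  do !case: ifP.
have two j k : j \in r -> k \in r -> j != k -> (d j + d k <= S)%N.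
  move=> jr kr ne_jk; rewrite /S (bigD1_seq j) //= leq_add2l.
  by rewrite big_mkcond (bigD1_seq k) //= [k == j]eq_sym ne_jk leq_addr.
have dom j : j \in r -> (forall k, k \in r -> k != j ->
    share (f0 k) (f1 k) (f2 k) (S - d k) = 0%N) ->
  (\sum_(j <- r) share (f0 j) (f1 j) (f2 j) (S - d j) <= 2)%N.
  move=> jr om0; rewrite (bigD1_seq j) //= big_seq_cond big1 ?addn0 // => k.
  by case/andP=> kr; apply: om0.
(* A dominating [j] forces [d k <= S - d j < d j <= S - d k] for every other [k], whose share is
   then 0. *)
have [/hasP[j jr lt_j]|no_lt] := boolP (has (fun j => S - d j < d j)%N r).
  apply: (dom j) => // k kr ne_kj; have := two j k jr kr.
  rewrite eq_sym in ne_kj; move=> /(_ ne_kj) le_S.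
  by rewrite /share -/(d k); case: ltnP => [|_]; [lia | case: eqP => //; lia].
(* A tie at a vertex with three single edges means S = 6; a tie elsewhere would also have [d k = 3],
   and [noK] forbids single edges to all of T there. *)
have [/hasP[j jr /andP[ones_j tie_j]]|no_ones] := boolP (has (fun j =>
    [&& f0 j == 1, f1 j == 1 & f2 j == 1]%N && (S - d j == d j)%N) r).
  apply: (dom j) => // k kr ne_kj; have ne_jk : j != k by rewrite eq_sym.
  have d3 : d j = 3%N by rewrite /d; case/and3P: ones_j => /eqP-> /eqP-> /eqP->.
  have le_S := two j k jr kr ne_jk; rewrite /share -/(d k).
  rewrite (negPf (noK j k jr kr ne_jk ones_j)).
  case: ltnP => [|_]; first by move/eqP: tie_j; lia.
  by case: eqP => // tie_k; case: eqP => //; move/eqP: tie_j; lia.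
(* The remaining nonzero shares equal 1 and occur only for [S = 4] and [d j = 2]. *)
have om_le j : j \in r -> share (f0 j) (f1 j) (f2 j) (S - d j) =
    ((S == 4%N) && (d j == 2%N)) :> nat.
  move=> jr; move/hasPn: no_lt => /(_ j jr); move/hasPn: no_ones => /(_ j jr).
  rewrite /share -/(d j) => no1 /negPf->;
    case: (S - d j =P d j)%N no1 => [tie|ntie].
    rewrite andbT => /negPf->; case: eqP => d2; last by rewrite andbF.
    by rewrite andbT; case: eqP => //; lia.
  by move=> _; case: eqP => // S4; case: eqP => // d2; lia.
rewrite big_seq (eq_bigr _ om_le) -big_seq.
case: (S =P 4%N) => [S4|_]; last by rewrite big1.
(* Twice each remaining share is at most [d j], and the [d j] add up to 4. *)
rewrite -(leq_pmul2l (isT : 0 < 2)%N) -[X in (_ <= X)%N]S4 /S big_distrr /=.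
by apply: leq_sum => j _; case: eqP => [->|].
Qed.

(* The multiplicity function of K_{2,3} on the vertices 0, 1 | 2, 3, 4; the    *)
(* code 5 stands for a vertex outside the graph.                               *)
Definition k23 (a b : nat) : nat :=
  [|| (a < 2) && (1 < b < 5) | (b < 2) && (1 < a < 5)]%N.

Definition k23_deg (a : nat) : nat := nth 0%N [:: 3; 3; 2; 2; 2]%N a.

Definition k23_value (t0 t1 t2 t3 : nat) : Z :=
  let p0 := (k23_deg t0 - (k23 t0 t1 + k23 t0 t2 + k23 t0 t3))%N in
  let p1 := (k23_deg t1 - (k23 t1 t0 + k23 t1 t2 + k23 t1 t3))%N in
  let p2 := (k23_deg t2 - (k23 t2 t0 + k23 t2 t1 + k23 t2 t3))%N in
  let p3 := (k23_deg t3 - (k23 t3 t0 + k23 t3 t1 + k23 t3 t2))%N in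
  if (p0 + p1 + p2 + p3 + (k23 t0 t1 + k23 t0 t2 + k23 t0 t3 + k23 t1 t2
      + k23 t1 t3 + k23 t2 t3) == 6)%N
  then quad_value p0 p1 p2 p3 (k23 t0 t1) (k23 t0 t2) (k23 t0 t3)
          (k23 t1 t2) (k23 t1 t3) (k23 t2 t3)
  else 0%coqZ.

Definition avoids (k t0 t1 t2 t3 : nat) : bool :=
  all (fun c => (c < 5) && (c != k))%N [:: t0; t1; t2; t3].

(** Distinct vertices have distinct codes, except that any number of them may lie outside the graph
    and have code 5. *)
Definition k23_compat (a b : nat) : bool := (a != b) || (a == 5)%N.

(** Omitting one of 2, 3, 4 from K_{2,3} gives a 4-set with coefficient 8, omitting 0 or 1 gives -8;
    a 4-set with a vertex outside the graph gives 0. Two of the three positive cases are set against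
    the two negative ones. *)
Definition k23_check (t0 t1 t2 t3 : nat) : bool :=
  let I k := Z.of_nat (avoids k t0 t1 t2 t3) in
  [&& k23_compat t0 t1, k23_compat t0 t2, k23_compat t0 t3,
      k23_compat t1 t2, k23_compat t1 t3 & k23_compat t2 t3] ==>
  (0 <=? k23_value t0 t1 t2 t3 - 8 * (I 2%N + I 3%N - I 0%N - I 1%N))%coqZ.

Lemma k23_check_all : all (fun t0 => all (fun t1 => all (fun t2 =>
  all (k23_check t0 t1 t2) (iota 0 6)) (iota 0 6)) (iota 0 6)) (iota 0 6).
Proof. by vm_compute. Qed.

(** * Averaging over relabellings *)

Section Averaging.

Variable N : nat.
Notation n := N.+1.
Notation graph := ('I_n -> 'I_n -> nat).
Implicit Types (h : graph) (s t : 'S_n).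

Definition swap (a b : nat) : 'S_n := tperm (inord a) (inord b).

Lemma inord_inj a b : (a < n)%N -> (b < n)%N ->
  ((inord a : 'I_n) == inord b) = (a == b).
Proof.
move=> lt_an lt_bn; apply/eqP/eqP => [/(congr1 val)|->] //.
by rewrite /= !inordK.
Qed.

Lemma swapE a b c : (a < n)%N -> (b < n)%N -> (c < n)%N ->
  swap a b (inord c) =
  inord (if c == a then b else if c == b then a else c).
Proof.
move=> lt_an lt_bn lt_cn; have [->|ne_ca] := eqVneq c a; first exact: tpermL.
have [->|ne_cb] := eqVneq c b; first exact: tpermR.
by rewrite tpermD // inord_inj // eq_sym.
Qed.

Lemma natg_relabel h s i j k l : s (inord i) = inord k -> s (inord j) = inord
  l ->
  natg (relabel h s) i j = natg h k l.
Proof. by rewrite /natg /relabel => -> ->. Qed.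

Lemma leavingS K h i : (K < n)%N -> leaving K h i = (natg h i K + leaving K.+1
  h i)%N.
Proof. by move=> lt_Kn; rewrite /leaving big_ltn. Qed.

Lemma uncoveredS K h : (K < n)%N -> uncovered K h = (leaving K.+1 h K +
  uncovered K.+1 h)%N.
Proof. by move=> lt_Kn; rewrite /uncovered big_ltn. Qed.

Lemma leaving_relabel K h s i k : s (inord i) = inord k ->
    (forall j, (K <= j < n)%N -> s (inord j) = inord j) ->
  leaving K (relabel h s) i = leaving K h k.
Proof.
move=> si fix_s; apply: eq_big_nat => j /fix_s sj; exact: natg_relabel.
Qed.

Lemma uncovered_relabel K h s :
    (forall j, (K <= j < n)%N -> s (inord j) = inord j) ->
  uncovered K (relabel h s) = uncovered K h.
Proof.
move=> fix_s; apply: eq_big_nat => i iK; apply: eq_big_nat => j jK.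
by apply: natg_relabel; apply: fix_s; lia.
Qed.

Lemma eq_table_coef tab h1 h2 : h1 =2 h2 ->
  table_coef tab (square_monomial h1) = table_coef tab (square_monomial h2).
Proof. by move=> eqh; rewrite (eq_square_monomial eqh). Qed.

Definition pair_coef h := table_coef pair_table (square_monomial h).
Definition triple_coef h := table_coef triple_table (square_monomial h).
Definition quad_coef h := table_coef quad_table (square_monomial h).

Definition pair_degree h (k : nat) : nat := (natg h 0 k + natg h 1 k)%N.

(** Each swap brings another pair of {0, 1, 2} to the positions 0, 1 and the third vertex to
    position 2. *)
Definition spread_coef h : rat :=
  3 * triple_coef h + 5 * ((pair_degree h 2)%:R * pair_coef h
    + (pair_degree (relabel h (swap 1 2)) 2)%:R * pair_coef (relabel h (swap 1
      2))
    + (pair_degree (relabel h (swap 0 2)) 2)%:R * pair_coef (relabel h (swap 0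
      2))).

(** The last argument is the number of other edges leaving T = {0, 1, 2} provided T covers all six
    edges; otherwise [spread_coef] vanishes. *)
Definition share_at h : nat :=
  share (natg h 0 3) (natg h 1 3) (natg h 2 3)
    (6 - (natg h 0 1 + natg h 0 2 + natg h 1 2)
     - (natg h 0 3 + natg h 1 3 + natg h 2 3)).

Definition shared_coef h : rat := (share_at h)%:R * spread_coef h.

Hypothesis n_ge12 : (12 <= n)%N.

Ltac small := try (move=> ?); rewrite swapE;
  [by [] || (do !case: eqP; lia || by []) | lia | lia | lia].

Variable G : graph.
Hypothesis simpleG : simple_graph G.
Hypothesis count6 : edge_count G = 6%N.

Definition permuted h := simple_graph h /\ edge_count h = 6%N.

Lemma permuted_relabel h s : permuted h -> permuted (relabel h s).
Proof.
by case=> hP h6; split; [apply: simple_relabel | rewrite edge_count_relabel].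
Qed.

Lemma count2 h : permuted h ->
  (natg h 0 1 + (leaving 2 h 0 + leaving 2 h 1) + uncovered 2 h = 6)%N.
Proof.
case=> hP <-; rewrite (edge_count_split h (_ : 2 <= n)%N); last by lia.
rewrite /index_iota; do !rewrite ?big_cons ?big_nil /=; lia.
Qed.

Lemma count3 h : permuted h ->
  (natg h 0 1 + natg h 0 2 + natg h 1 2
   + (leaving 3 h 0 + leaving 3 h 1 + leaving 3 h 2) + uncovered 3 h = 6)%N.
Proof.
case=> hP <-; rewrite (edge_count_split h (_ : 3 <= n)%N); last by lia.
rewrite /index_iota; do !rewrite ?big_cons ?big_nil /=; lia.
Qed.

Lemma count4 h : permuted h ->
  (natg h 0 1 + natg h 0 2 + natg h 0 3 + natg h 1 2 + natg h 1 3 + natg h 2 3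
   + (leaving 4 h 0 + leaving 4 h 1 + leaving 4 h 2 + leaving 4 h 3) +
     uncovered 4 h = 6)%N.
Proof.
case=> hP <-; rewrite (edge_count_split h (_ : 4 <= n)%N); last by lia.
rewrite /index_iota; do !rewrite ?big_cons ?big_nil /=; lia.
Qed.

Lemma pair_coefE h : pair_coef h =
  if uncovered 2 h == 0%N then ZtoQ (pair_value (leaving 2 h 0) (leaving 2 h
    1) (natg h 0 1)) else 0.
Proof. by rewrite /pair_coef (@table_coef_square_monomial _ _ 2) //; lia. Qed.

Lemma triple_coefE h : triple_coef h =
  if uncovered 3 h == 0%N then
    ZtoQ (triple_value (leaving 3 h 0) (leaving 3 h 1) (leaving 3 h 2)
             (natg h 0 1) (natg h 0 2) (natg h 1 2)) else 0.
Proof. by rewrite /triple_coef (@table_coef_square_monomial _ _ 3) //; lia. Qed.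

Lemma quad_coefE h : quad_coef h =
  if uncovered 4 h == 0%N then
    ZtoQ (quad_value (leaving 4 h 0) (leaving 4 h 1) (leaving 4 h 2) (leaving
      4 h 3)
             (natg h 0 1) (natg h 0 2) (natg h 0 3)
             (natg h 1 2) (natg h 1 3) (natg h 2 3)) else 0.
Proof. by rewrite /quad_coef (@table_coef_square_monomial _ _ 4) //; lia. Qed.

Lemma pair_coef_ge0 h : permuted h -> 0 <= pair_coef h.
Proof.
move=> hP; rewrite pair_coefE; case: eqP => // r0.
by apply/ZtoQ_ge0/pair_value_ge0; have := count2 hP; lia.
Qed.

(** A pair in {0, 1, 2} covers all edges exactly when the triple does and the third vertex sends no
    edge out of it; this is the case distinction on [p0], [p1], [p2] in [spread_value]. *)
Lemma spread_coefE h : simple_graph h -> spread_coef h =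
  if uncovered 3 h == 0%N then
    ZtoQ (spread_value (leaving 3 h 0) (leaving 3 h 1) (leaving 3 h 2)
             (natg h 0 1) (natg h 0 2) (natg h 1 2)) else 0.
Proof.
move=> hP; have lt2n : (2 < n)%N by lia.
have fix12 j : (3 <= j < n)%N -> swap 1 2 (inord j) = inord j by small.
have fix02 j : (3 <= j < n)%N -> swap 0 2 (inord j) = inord j by small.
rewrite /spread_coef triple_coefE !pair_coefE /pair_degree !(leavingS _ _
  lt2n) !(uncoveredS _ lt2n).
rewrite !(uncovered_relabel _ fix12) !(uncovered_relabel _ fix02).
rewrite (@leaving_relabel 3 h (swap 1 2) 0 0 _ fix12); last by small.
rewrite (@leaving_relabel 3 h (swap 1 2) 1 2 _ fix12); last by small.
rewrite (@leaving_relabel 3 h (swap 1 2) 2 1 _ fix12); last by small.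
rewrite (@leaving_relabel 3 h (swap 0 2) 0 2 _ fix02); last by small.
rewrite (@leaving_relabel 3 h (swap 0 2) 1 1 _ fix02); last by small.
rewrite (@leaving_relabel 3 h (swap 0 2) 2 0 _ fix02); last by small.
have -> : natg (relabel h (swap 1 2)) 0 1 = natg h 0 2 by apply: natg_relabel;
  small.
have -> : natg (relabel h (swap 1 2)) 0 2 = natg h 0 1 by apply: natg_relabel;
  small.
have -> : natg (relabel h (swap 1 2)) 1 2 = natg h 1 2.
  by rewrite (natg_sym 1 2 hP); apply: natg_relabel; small.
have -> : natg (relabel h (swap 0 2)) 0 1 = natg h 1 2.
  by rewrite (natg_sym 1 2 hP); apply: natg_relabel; small.
have -> : natg (relabel h (swap 0 2)) 0 2 = natg h 0 2.
  by rewrite (natg_sym 0 2 hP); apply: natg_relabel; small.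
have -> : natg (relabel h (swap 0 2)) 1 2 = natg h 0 1.
  by rewrite (natg_sym 0 1 hP); apply: natg_relabel; small.
rewrite !addn_eq0; case r3: (uncovered 3 h == 0%N);
  last by rewrite !andbF /= ?(mulr0, addr0).
rewrite !andbT /spread_value !ZtoQD !ZtoQM !ZtoQD.
have num k : ZtoQ (Z.of_nat k) = k%:R by exact: ZtoQ_nat.
rewrite -[ZtoQ 3%coqZ]/3%:R -[ZtoQ 5%coqZ]/5%:R; congr (_ + _ * (_ + _ + _)).
- by case: (leaving 3 h 2) => [|?] /=; rewrite ?ZtoQ0 ?mulr0 // ZtoQM num.
- by case: (leaving 3 h 1) => [|?] /=; rewrite ?ZtoQ0 ?mulr0 // ZtoQM num.
- by case: (leaving 3 h 0) => [|?] /=; rewrite ?ZtoQ0 ?mulr0 // ZtoQM num.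
Qed.

Lemma spread_coef_ge0 h : permuted h -> 0 <= spread_coef h.
Proof.
move=> hP; rewrite spread_coefE; last by case: hP.
case: eqP => // r0; apply/ZtoQ_ge0/spread_value_ge0; have := count3 hP; lia.
Qed.

Lemma table_coef_fix K tab h s : simple_graph h ->
    all (fun c => size c.2 == K) tab ->
    (forall k, (k < K)%N -> s (inord k) = inord k) ->
  table_coef tab (square_monomial (relabel h s)) = table_coef tab
    (square_monomial h).
Proof.
move=> hP /allP sz_tab fix_s;
  apply: table_coef_relabel => // c i /sz_tab/eqP sz_t.
have [lt_iK|le_Ki] := ltnP i K; first by have := fix_s i lt_iK;
  rewrite inord_val => ->.
rewrite [RHS]nth_default ?sz_t // nth_default // sz_t leqNgt;
  apply/negP => lt_siK.
have := fix_s _ lt_siK; rewrite inord_val => /perm_inj eq_si.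
by rewrite eq_si ltnNge le_Ki in lt_siK.
Qed.

Lemma swap_fix K a b k : (K <= a < n)%N -> (K <= b < n)%N -> (k < K)%N ->
  swap a b (inord k) = inord k.
Proof.
move=> aK bK lt_kK; rewrite swapE; [|lia|lia|lia].
by rewrite !ltn_eqF //; lia.
Qed.

(** For fixed [j] the swap only permutes the relabellings. The identity turns a quantity read at
    position [K] into its total over all positions outside the first [K]. *)
Lemma sum_swap K (f : graph -> rat) h :
    (K <= n)%N -> (forall h1 h2, h1 =2 h2 -> f h1 = f h2) ->
  \sum_s \sum_(K <= j < n) f (relabel (relabel h s) (swap K j)) =
  (n - K)%:R * \sum_s f (relabel h s).
Proof.
move=> le_Kn eqf; rewrite exchange_big /=.
rewrite (eq_bigr (fun _ => \sum_s f (relabel h s))) => [|j _];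
  last exact: sum_relabel.
by rewrite sumr_const_nat mulr_natl.
Qed.

Lemma eq_pair_coef h1 h2 : h1 =2 h2 -> pair_coef h1 = pair_coef h2.
Proof. by move=> eqh; apply: eq_table_coef. Qed.

Lemma eq_pair_degree h1 h2 k : h1 =2 h2 -> pair_degree h1 k = pair_degree h2 k.
Proof. by move=> eqh; rewrite /pair_degree /natg !eqh. Qed.

Lemma eq_relabel h1 h2 s : h1 =2 h2 -> relabel h1 s =2 relabel h2 s.
Proof. by move=> eqh i j; apply: eqh. Qed.

Lemma eq_spread_coef h1 h2 : h1 =2 h2 -> spread_coef h1 = spread_coef h2.
Proof.
move=> eqh; rewrite /spread_coef /triple_coef (eq_table_coef _ eqh)
  (eq_pair_coef eqh) (eq_pair_degree _ eqh).
rewrite !(eq_pair_coef (eq_relabel _ eqh)) (eq_pair_degree _ (eq_relabel (swap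
  1 2) eqh)).
by rewrite (eq_pair_degree _ (eq_relabel (swap 0 2) eqh)).
Qed.

Lemma eq_share_at h1 h2 : h1 =2 h2 -> share_at h1 = share_at h2.
Proof. by move=> eqh; rewrite /share_at /natg !eqh. Qed.

Definition degree_pair_coef h : rat := (pair_degree h 2)%:R * pair_coef h.

Lemma eq_degree_pair_coef h1 h2 : h1 =2 h2 -> degree_pair_coef h1 =
  degree_pair_coef h2.
Proof. by move=> eqh;
  rewrite /degree_pair_coef (eq_pair_coef eqh) (eq_pair_degree _ eqh). Qed.

(** Moving the third vertex over all n - 2 >= 10 positions adds up its degrees into the pair, and at
    most six edges leave the pair: hence 10 against 6. *)
Lemma sum_degree_pair_coef : 5 * \sum_s degree_pair_coef (relabel G s) <= 3 *
  \sum_s pair_coef (relabel G s).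
Proof.
have DL_ge0 s : 0 <= degree_pair_coef (relabel G s).
  by apply: mulr_ge0 => //; apply/pair_coef_ge0/permuted_relabel.
have le_sum : (n - 2)%:R * \sum_s degree_pair_coef (relabel G s) <= 6 * \sum_s
  pair_coef (relabel G s).
  rewrite -sum_swap //; first last. exact: eq_degree_pair_coef. by lia.
  rewrite mulr_sumr; apply: ler_sum => s _; set h := relabel G s.
  have hP : permuted h by apply: permuted_relabel.
  rewrite (eq_big_nat _ _ (F2 := fun j => (pair_degree h j)%:R * pair_coef h));
    last first.
    move=> j jn; rewrite /degree_pair_coef /pair_coef (@table_coef_fix 2) //;
      first last.
    - by move=> k lt_k2; apply: (@swap_fix 2) => //; lia.
    - by case: hP.
    congr (_ * _); rewrite /pair_degree; congr (_%:R); congr (_ + _)%N.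
      by apply: natg_relabel; rewrite ?tpermL // (@swap_fix 2) //; lia.
    by apply: natg_relabel; rewrite ?tpermL // (@swap_fix 2) //; lia.
  rewrite -mulr_suml -natr_sum big_split /= -/(leaving 2 h 0) -/(leaving 2 h 1).
  case: (eqVneq (uncovered 2 h) 0%N) => [r0|rN0]; last first.
    by rewrite pair_coefE (negPf rN0) !mulr0.
  apply: ler_wpM2r; first exact: pair_coef_ge0.
  by rewrite ler_nat; have := count2 hP; lia.
have : 10 * \sum_s degree_pair_coef (relabel G s) <= (n - 2)%:R * \sum_s
  degree_pair_coef (relabel G s).
  apply: ler_wpM2r; first by apply: sumr_ge0.
  by rewrite ler_nat; lia.
lra.
Qed.

Definition base_coef h : rat := 3 * pair_coef h + triple_coef h.

(** The three pairs of a triple contribute equal sums, which gives the coefficient 15 = 3 * 5; the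
    previous bound replaces these pair terms by 9 times the pair sum. *)
Lemma sum_spread_coef_le : \sum_s spread_coef (relabel G s) <= 3 * \sum_s
  base_coef (relabel G s).
Proof.
have -> : \sum_s spread_coef (relabel G s) =
    3 * \sum_s triple_coef (relabel G s) + 15 * \sum_s degree_pair_coef
      (relabel G s).
  rewrite /spread_coef big_split /= -mulr_sumr; congr (_ + _).
  rewrite -mulr_sumr !big_split /= -/(degree_pair_coef _).
  rewrite (sum_relabel G (swap 1 2) eq_degree_pair_coef) (sum_relabel G (swap
    0 2) eq_degree_pair_coef).
  by rewrite /degree_pair_coef; ring.
rewrite /base_coef big_split /= -mulr_sumr.
by have := sum_degree_pair_coef; lra.
Qed.

(** Only containment is tested; for a graph with six edges it amounts to equality with K_{2,3} up to
    isolated vertices. *)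
Definition K23 h : bool :=
  [exists i0, exists i1, exists l0, exists l1, exists l2,
   uniq [:: i0; i1; l0; l1; l2] &&
   [&& h i0 l0 == 1, h i0 l1 == 1, h i0 l2 == 1,
       h i1 l0 == 1, h i1 l1 == 1 & h i1 l2 == 1]%N].

Lemma K23P h : reflect (exists i0 i1 l0 l1 l2 : 'I_n,
    uniq [:: i0; i1; l0; l1; l2] /\
    [/\ h i0 l0 = 1%N, h i0 l1 = 1%N & h i0 l2 = 1%N] /\
    [/\ h i1 l0 = 1%N, h i1 l1 = 1%N & h i1 l2 = 1%N]) (K23 h).
Proof.
apply: (iffP existsP) => [[i0 /existsP[i1 /existsP[l0 /existsP[l1]]]]|].
  move=> /existsP[l2 /andP[uniq_v]].
  move=> /and5P[/eqP ? /eqP ? /eqP ? /eqP ? /andP[/eqP ? /eqP ?]].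
  by exists i0, i1, l0, l1, l2.
move=> [i0 [i1 [l0 [l1 [l2 [uniq_v [[a0 a1 a2] [b0 b1 b2]]]]]]]].
exists i0; apply/existsP; exists i1; apply/existsP; exists l0.
apply/existsP; exists l1; apply/existsP; exists l2.
by rewrite uniq_v a0 a1 a2 b0 b1 b2.
Qed.

Lemma K23_relabel h s : K23 (relabel h s) -> K23 h.
Proof.
move=> /K23P[i0 [i1 [l0 [l1 [l2 [uniq_v hv]]]]]]; apply/K23P.
exists (s i0), (s i1), (s l0), (s l1), (s l2); split=> //.
by rewrite -[[:: _; _; _; _; _]]/(map s [:: i0; i1; l0; l1;
  l2]) map_inj_uniq //; apply: perm_inj.
Qed.

Lemma relabelC h s t : (s * t = t * s)%g ->
  relabel (relabel h s) t =2 relabel (relabel h t) s.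
Proof. by move=> st i j; rewrite !relabel_mul st. Qed.

Lemma swapC a b c d : (a < n)%N -> (b < n)%N -> (c < n)%N -> (d < n)%N ->
    a != c -> a != d -> b != c -> b != d ->
  (swap a b * swap c d = swap c d * swap a b)%g.
Proof.
move=> an bn cn dn ac ad bc bd; rewrite conjgC tpermJ !tpermD // !inord_inj //.
all: by rewrite eq_sym.
Qed.

(** [swap 3 j] fixes 0, 1, 2 and commutes with the swaps used in [spread_coef]. *)
Lemma spread_coef_swap h j : simple_graph h -> (3 <= j < n)%N ->
  spread_coef (relabel h (swap 3 j)) = spread_coef h.
Proof.
move=> hP jn; have hsP := simple_relabel (swap 3 j) hP.
have fix3 k : (k < 3)%N -> swap 3 j (inord k) = inord k.
  by move=> lt_k3; apply: (@swap_fix 3) => //; lia.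
have fixL2 h' : simple_graph h' -> pair_coef (relabel h' (swap 3 j)) =
  pair_coef h'.
  by move=> h'P; apply: (@table_coef_fix 2) => // k lt_k2; apply: fix3; lia.
have fixd h' : pair_degree (relabel h' (swap 3 j)) 2 = pair_degree h' 2.
  by rewrite /pair_degree; congr (_ + _)%N; apply: natg_relabel; apply: fix3.
have C12 := @relabelC h (swap 3 j) (swap 1 2) (swapC _ _ _ _ _ _ _ _).
have C02 := @relabelC h (swap 3 j) (swap 0 2) (swapC _ _ _ _ _ _ _ _).
rewrite /spread_coef {1}/triple_coef (@table_coef_fix 3) // -/(triple_coef h)
  fixL2 // fixd.
rewrite (eq_pair_coef (C12 _ _ _ _ _ _ _ _)) ?(eq_pair_coef (C02 _ _ _ _ _ _ _
  _)); try lia.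
rewrite (eq_pair_degree _ (C12 _ _ _ _ _ _ _ _)) ?(eq_pair_degree _ (C02 _ _ _
  _ _ _ _ _)); try lia.
by rewrite !fixd !fixL2 //; apply: simple_relabel.
Qed.

Lemma eq_shared_coef h1 h2 : h1 =2 h2 -> shared_coef h1 = shared_coef h2.
Proof. by move=> eqh;
  rewrite /shared_coef (eq_share_at eqh) (eq_spread_coef eqh). Qed.

(** Let the fourth vertex run over all positions outside a covering triple: by [share_sum_le2] the
    doubled fractions add up to at most 2. *)
Lemma sum_shared_coef : ~ K23 G ->
  (n - 3)%:R * \sum_s shared_coef (relabel G s) <= 2 * \sum_s spread_coef
    (relabel G s).
Proof.
move=> noK; rewrite -sum_swap //; first last. exact: eq_shared_coef. by lia.
rewrite mulr_sumr; apply: ler_sum => s _; set h := relabel G s.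
have hP : permuted h by apply: permuted_relabel.
case: (eqVneq (uncovered 3 h) 0%N) => [r0|rN0]; last first.
  rewrite spread_coefE ?(negPf rN0) ?mulr0; last by case: hP.
  rewrite big_nat big1 // => j jn; rewrite /shared_coef spread_coef_swap //;
    last by case: hP.
  by rewrite spread_coefE ?(negPf rN0) ?mulr0 //; case: hP.
pose d j := (natg h 0 j + natg h 1 j + natg h 2 j)%N.
pose S := (\sum_(3 <= j < n) d j)%N.
have SE : S = (6 - (natg h 0 1 + natg h 0 2 + natg h 1 2))%N.
  rewrite /S /d !big_split /= -!/(leaving 3 h _).
  by have := count3 hP; lia.
rewrite (eq_big_nat _ _ (F2 := fun j =>
    (share (natg h 0 j) (natg h 1 j) (natg h 2 j) (S - d j))%:R * spread_coef
      h)); last first.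
  move=> j jn; rewrite /shared_coef spread_coef_swap //; last by case: hP.
  have fix3 k : (k < 3)%N -> swap 3 j (inord k) = inord k.
    by move=> lt_k3; apply: (@swap_fix 3) => //; lia.
  have s3 : swap 3 j (inord 3) = inord j by apply: tpermL.
  rewrite /share_at SE /d.
  have f0 := fix3 0%N isT; have f1 := fix3 1%N isT; have f2 := fix3 2 isT.
  rewrite (natg_relabel _ f0 f1) (natg_relabel _ f0 f2) (natg_relabel _ f1 f2).
  by rewrite (natg_relabel _ f0 s3) (natg_relabel _ f1 s3) (natg_relabel _ f2
    s3).
rewrite -mulr_suml -natr_sum; apply: ler_wpM2r; first exact: spread_coef_ge0.
rewrite ler_nat; apply: share_sum_le2; first exact: iota_uniq.
move=> j k; rewrite !mem_index_iota
  => jn kn ne_jk /and3P[/eqP h0j /eqP h1j /eqP h2j].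
(* Two vertices [j], [k] each joined by single edges to 0, 1, 2 would be the small side of a
   K_{2,3}. *)
apply/negP => /and3P[/eqP h0k /eqP h1k /eqP h2k]; apply: noK.
apply: (@K23_relabel _ s); apply/K23P.
have h_sym := natg_sym _ _ (proj1 hP).
exists (inord j), (inord k), (inord 0), (inord 1), (inord 2); split.
  rewrite /= !inE !inord_inj; try lia.
by split; split; rewrite -[LHS]/(natg h _ _) h_sym.
Qed.

Lemma shared_coefE h : permuted h -> uncovered 4 h = 0%N -> shared_coef h =
  ZtoQ (shared_value (leaving 4 h 0) (leaving 4 h 1) (leaving 4 h 2) (leaving
    4 h 3)
           (natg h 0 3) (natg h 1 3) (natg h 2 3)
           (natg h 0 1) (natg h 0 2) (natg h 1 2)).
Proof.
move=> hP r4; have lt3n : (3 < n)%N by lia.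
have := count4 hP; rewrite r4 => h6.
rewrite /shared_coef spread_coefE; last by case: hP.
rewrite (uncoveredS _ lt3n) r4 !(leavingS _ _ lt3n) addn0 /share_at
  /shared_value.
case q3: (leaving 4 h 3) => [|q] /=; last by rewrite mulr0.
rewrite ZtoQM ZtoQ_nat; congr (_%:R * _); congr share.
by rewrite q3 in h6; lia.
Qed.

Lemma shared_quad_ge0 h : permuted h ->
  0 <= 2 * (shared_coef h + shared_coef (relabel h (swap 2 3)) + shared_coef
    (relabel h (swap 1 3))
            + shared_coef (relabel h (swap 0 3))) + 3 * quad_coef h.
Proof.
move=> hP; have [sP _] := hP.
have YL_ge0 s : 0 <= shared_coef (relabel h s).
  by apply: mulr_ge0 => //; apply/spread_coef_ge0/permuted_relabel.
have YLh_ge0 : 0 <= shared_coef h by apply: mulr_ge0 => //;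
  apply: spread_coef_ge0.
have Y2 := YL_ge0 (swap 2 3); have Y1 := YL_ge0 (swap 1 3).
have Y0 := YL_ge0 (swap 0 3).
rewrite quad_coefE; case: eqP => [r4|_]; last by lra.
have := local_checkT (_ : (leaving 4 h 0 + leaving 4 h 1 + leaving 4 h 2 +
  leaving 4 h 3
  + (natg h 0 1 + natg h 0 2 + natg h 0 3 + natg h 1 2 + natg h 1 3 + natg h 2
    3)
  = 6)%N); rewrite /local_check.
move=> /(_ _)/wrap[]; first by have := count4 hP; lia.
(* If the 4-set coefficient is nonnegative, all terms are. Otherwise the swaps identify the four
   shared coefficients with those in [local_check]. *)
case: ifP => [/ZtoQ_ge0 c_ge0 _|_ /ZtoQ_ge0]; first by lra.
have fix4 a b : (a < 4)%N -> (b < 4)%N -> forall j, (4 <= j < n)%N ->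
    swap a b (inord j) = inord j.
  move=> lt_a4 lt_b4 j jn; rewrite swapE; [|lia|lia|lia].
  by rewrite !gtn_eqF //; lia.
have fix23 := fix4 2 3 isT isT; have fix13 := fix4 1%N 3 isT isT.
have fix03 := fix4 0%N 3 isT isT.
rewrite ZtoQD !ZtoQM !ZtoQD -!shared_coefE //.
rewrite (shared_coefE (permuted_relabel (swap 2 3) hP));
  last by rewrite uncovered_relabel.
rewrite (shared_coefE (permuted_relabel (swap 1 3) hP));
  last by rewrite uncovered_relabel.
rewrite (shared_coefE (permuted_relabel (swap 0 3) hP));
  last by rewrite uncovered_relabel.
rewrite (@leaving_relabel 4 h (swap 2 3) 0 0 _ fix23); last by small.
rewrite (@leaving_relabel 4 h (swap 2 3) 1 1 _ fix23); last by small.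
rewrite (@leaving_relabel 4 h (swap 2 3) 2 3 _ fix23); last by small.
rewrite (@leaving_relabel 4 h (swap 2 3) 3 2 _ fix23); last by small.
rewrite (@leaving_relabel 4 h (swap 1 3) 0 0 _ fix13); last by small.
rewrite (@leaving_relabel 4 h (swap 1 3) 1 3 _ fix13); last by small.
rewrite (@leaving_relabel 4 h (swap 1 3) 2 2 _ fix13); last by small.
rewrite (@leaving_relabel 4 h (swap 1 3) 3 1 _ fix13); last by small.
rewrite (@leaving_relabel 4 h (swap 0 3) 0 3 _ fix03); last by small.
rewrite (@leaving_relabel 4 h (swap 0 3) 1 1 _ fix03); last by small.
rewrite (@leaving_relabel 4 h (swap 0 3) 2 2 _ fix03); last by small.
rewrite (@leaving_relabel 4 h (swap 0 3) 3 0 _ fix03); last by small.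
have natgE a b i j : (a < 4)%N -> (b < 4)%N -> (i < 4)%N -> (j < 4)%N ->
    natg (relabel h (swap a b)) i j =
    natg h (if i == a then b else if i == b then a else i)
           (if j == a then b else if j == b then a else j).
  by move=> a4 b4 i4 j4; apply: natg_relabel; rewrite swapE //; lia.
rewrite !natgE //=.
rewrite (natg_sym 3 2 sP) (natg_sym 3 1 sP) (natg_sym 2 1 sP).
by rewrite (natg_sym 3 0 sP) (natg_sym 1 0 sP) (natg_sym 2 0 sP).
Qed.

Lemma sum_ge0_generic : ~ K23 G ->
  0 <= 16 * \sum_s base_coef (relabel G s) + (n%:R - 3) * \sum_s quad_coef
    (relabel G s).
Proof.
move=> noK; have yv := sum_shared_coef noK; have vw := sum_spread_coef_le.
set y := \sum_s shared_coef _ in yv; set c := \sum_s quad_coef _;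
  set v := \sum_s spread_coef _ in yv vw.
set w := \sum_s base_coef _ in vw *.
(* Each of the four triples of a 4-set contributes the same sum [y], whence 8 = 2 * 4. *)
have yc : 0 <= 8 * y + 3 * c.
  have : 0 <= \sum_s (2 * (shared_coef (relabel G s)
      + shared_coef (relabel (relabel G s) (swap 2 3))
      + shared_coef (relabel (relabel G s) (swap 1 3))
      + shared_coef (relabel (relabel G s) (swap 0 3))) + 3 * quad_coef
        (relabel G s)).
    by apply: sumr_ge0 => s _; apply: shared_quad_ge0; apply: permuted_relabel.
  rewrite big_split -!mulr_sumr !big_split /= !(sum_relabel G _
    eq_shared_coef) -/y -/c.
  by rewrite (_ : 2 * _ = 8 * y) //; ring.
rewrite natrB in yv; last by lia.
have n3 : 0 <= n%:R - 3 :> rat by rewrite subr_ge0 ler_nat; lia.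
have := mulr_ge0 n3 yc; rewrite mulrDr => ny.
by nra.
Qed.

(** * The exceptional graph K_{2,3} *)

Section K23Case.

Variables i0 i1 l0 l1 l2 : 'I_n.
Let v := [:: i0; i1; l0; l1; l2].
Hypothesis uniq_v : uniq v.
Hypothesis adj0 : [/\ G i0 l0 = 1%N, G i0 l1 = 1%N & G i0 l2 = 1%N].
Hypothesis adj1 : [/\ G i1 l0 = 1%N, G i1 l1 = 1%N & G i1 l2 = 1%N].

(** [index] returns the length 5 for vertices not in [v], which is the code of an outside vertex. *)
Let code (u : 'I_n) : nat := index u v.
Let vtx (k : nat) : 'I_n := nth i0 v k.

Lemma code_vtx k : (k < 5)%N -> code (vtx k) = k.
Proof. by move=> lt_k5; apply: index_uniq. Qed.

Lemma vtx_code u : (code u < 5)%N -> vtx (code u) = u.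
Proof. by rewrite -[5%N]/(size v) index_mem => uv; apply: nth_index. Qed.

Lemma code_lt6 u : (code u < 6)%N.
Proof. by rewrite ltnS; apply: index_size. Qed.

Lemma sum_code (F : nat -> nat) : F 5 = 0%N ->
  (\sum_(u : 'I_n) F (code u) = F 0 + F 1 + F 2 + F 3 + F 4)%N.
Proof.
move=> F5; rewrite (bigID (fun u => u \in v)) /= [X in (_ + X)%N]big1
  => [|u uNv].
  rewrite addn0 -big_uniq //= (eq_bigr (fun u => F (code u))) //.
  have E k : (k < 5)%N -> F (code (vtx k)) = F k by move=> /code_vtx ->.
  rewrite !big_cons big_nil (E 0%N) // (E 1%N) // (E 2) // (E 3) // (E 4) //.
  by rewrite addn0 !addnA.
by rewrite /code memNindex.
Qed.

Lemma sum_G : (\sum_u \sum_w G u w = 12)%N.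
Proof.
have [G_sym G0] := simpleG.
rewrite -[12%N]/(6 + 6)%N -{1}count6 -count6 /edge_count.
rewrite [X in _ = (_ + X)%N](exchange_big_dep xpredT) //= -big_split /=.
apply: eq_bigr => u _; rewrite (bigID (fun w : 'I_n => u < w)%N) /=;
  congr (_ + _)%N.
rewrite (bigID (fun w : 'I_n => w < u)%N) /= [X in (_ + X)%N]big1 ?addn0
  => [|w].
  by apply: eq_big => [w|w _]; [case: ltngtP | apply: G_sym].
by rewrite -!leqNgt -eqn_leq => /eqP/val_inj->.
Qed.

Lemma k23_sym a b : k23 a b = k23 b a.
Proof. by rewrite /k23 orbC. Qed.

(** [G] dominates K_{2,3} entry by entry, and both matrices have total 12, so they coincide. *)
Lemma G_code u w : G u w = k23 (code u) (code w).
Proof.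
have [G_sym _] := simpleG.
have G_ge u' w' : (k23 (code u') (code w') <= G u' w')%N.
  case: (leqP (k23 (code u') (code w')) 0) => [|k_gt0].
    by rewrite leqn0 => /eqP->.
  wlog lt_u2 : u' w' k_gt0 / (code u' < 2)%N.
    move=> IH; case: (ltnP (code u') 2) => [|le_2u]; first exact: IH.
    rewrite k23_sym G_sym; apply: IH; first by rewrite k23_sym.
    move: k_gt0; rewrite /k23 lt0b => /orP[/andP[lt_u2 _]|/andP[]] //.
    by rewrite leqNgt lt_u2 in le_2u.
  have /andP[lt_1w lt_w5] : (1 < code w' < 5)%N.
    move: k_gt0; rewrite /k23 lt0b => /orP[/andP[]|/andP[_ /andP[lt_1u _]]] //.
    by rewrite ltnNge -ltnS lt_u2 in lt_1u.
  rewrite -(vtx_code (ltn_trans lt_u2 (isT : 2 < 5)%N)) -(vtx_code lt_w5).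
  rewrite !code_vtx //; last exact: ltn_trans lt_u2 _.
  case: adj0 adj1 => a00 a01 a02 [a10 a11 a12].
  move: (code u') (code w') lt_u2 lt_1w lt_w5.
  by move=> [|[|?]] [|[|[|[|[|?]]]]] //= _ _ _;
    rewrite /vtx /= ?a00 ?a01 ?a02 ?a10 ?a11 ?a12.
have sum_k : (\sum_u \sum_w k23 (code u) (code w) = 12)%N.
  rewrite (sum_code (F := fun a => \sum_w k23 a (code w))%N) /=.
    by rewrite !(sum_code (F := k23 _)).
  by apply: big1 => z _; rewrite /k23 /= andbF.
have /eqP sum_diff : (\sum_u \sum_w (G u w - k23 (code u) (code w)) == 0)%N.
  rewrite -(eqn_add2l (\sum_u \sum_w k23 (code u) (code w))) -big_split /=.
  rewrite addn0 sum_k -sum_G; apply/eqP/eq_bigr => u' _.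
  by rewrite -big_split /=; apply: eq_bigr => w' _; rewrite subnKC.
apply/eqP; rewrite eqn_leq G_ge andbT -subn_eq0.
move/eqP: sum_diff; rewrite sum_nat_eq0 => /forallP/(_ u) /=.
by rewrite sum_nat_eq0 => /forallP/(_ w).
Qed.

(** This is the degree of the vertex placed at position [i], split according to whether the other
    end lies in the first four positions. *)
Lemma leaving4_code s i : (i < n)%N -> let t k := code (s (inord k)) in
  (k23 (t i) (t 0) + k23 (t i) (t 1) + k23 (t i) (t 2) + k23 (t i) (t 3)
   + leaving 4 (relabel G s) i = k23_deg (t i))%N.
Proof.
move=> lt_in t.
transitivity (\sum_(j < n) natg (relabel G s) i j)%N.
  rewrite -(big_mkord xpredT (natg (relabel G s) i)).
  rewrite (@big_cat_nat _ _ _ 4) //=; last by lia.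
  rewrite -/(leaving 4 (relabel G s) i) /index_iota /= !big_cons big_nil.
  by rewrite /natg /relabel !G_code addn0 !addnA.
transitivity (\sum_w G (s (inord i)) w)%N.
  rewrite [RHS](reindex_inj (@perm_inj _ s)); apply: eq_bigr => j _.
  by rewrite /natg /relabel inord_val.
rewrite (eq_bigr (fun w => k23 (t i) (code w))) => [|w _]; last exact: G_code.
rewrite sum_code; last by rewrite /k23 /= andbF.
by have := code_lt6 (s (inord i)); rewrite -/(t i);
  move: (t i) => [|[|[|[|[|[|]]]]]].
Qed.

Definition avoid (k : nat) s : rat :=
  (avoids k (code (s (inord 0))) (code (s (inord 1)))
            (code (s (inord 2))) (code (s (inord 3))))%:R.

Lemma quad_coef_ge_avoid s :
  8 * (avoid 2 s + avoid 3 s - avoid 0 s - avoid 1 s) <= quad_coef (relabel G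
    s).
Proof.
pose t k := code (s (inord k)).
have hP : permuted (relabel G s) by apply: permuted_relabel.
have p0 := @leaving4_code s 0 isT; have p1 := @leaving4_code s 1 (_ : 1 < n)%N.
have {}p1 := p1 (ltnW (ltnW (ltnW (ltnW (ltnW (ltnW (ltnW (ltnW (ltnW (ltnW
  n_ge12)))))))))).
have lt2n : (2 < n)%N by lia. have lt3n : (3 < n)%N by lia.
have p2 := leaving4_code s lt2n; have p3 := leaving4_code s lt3n.
move: p0 p1 p2 p3 => /= p0 p1 p2 p3.
have K0 a : k23 a a = 0%N.
  by rewrite /k23 -ltnS; case: a => [|[|[|[|[|[|?]]]]]].
have c4 := count4 hP.
have natgE i j : natg (relabel G s) i j = k23 (t i) (t j).
  by rewrite /natg /relabel G_code.
rewrite !natgE in c4.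
have -> : quad_coef (relabel G s) = ZtoQ (k23_value (t 0%N) (t 1%N) (t 2) (t
  3)).
  rewrite quad_coefE !natgE /k23_value -/(t _).
  rewrite -(_ : leaving 4 (relabel G s) 0 = k23_deg (t 0%N) - _)%N; last first.
    by rewrite -p0 K0 add0n addKn.
  rewrite -(_ : leaving 4 (relabel G s) 1 = k23_deg (t 1%N) - _)%N; last first.
    by rewrite -p1 K0 addn0 addKn.
  rewrite -(_ : leaving 4 (relabel G s) 2 = k23_deg (t 2) - _)%N; last first.
    by rewrite -p2 K0 addn0 addKn.
  rewrite -(_ : leaving 4 (relabel G s) 3 = k23_deg (t 3) - _)%N; last first.
    by rewrite -p3 K0 addn0 addKn.
  (* By [count4], the 4-set covers all edges exactly when the edges counted at it number six. *)
  have -> : (uncovered 4 (relabel G s) == 0%N) = (leaving 4 (relabel G s) 0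
     + leaving 4 (relabel G s) 1 + leaving 4 (relabel G s) 2 + leaving 4
       (relabel G s) 3
     + (k23 (t 0) (t 1) + k23 (t 0) (t 2) + k23 (t 0) (t 3) + k23 (t 1) (t 2)
      + k23 (t 1) (t 3) + k23 (t 2) (t 3)) == 6)%N.
    by apply/eqP/eqP; lia.
  by case: ifP.
have t_lt k : t k \in iota 0 6 by rewrite mem_iota code_lt6.
have compat i j : (i < n)%N -> (j < n)%N -> i != j -> k23_compat (t i) (t j).
  move=> lt_in lt_jn ne_ij; rewrite /k23_compat; case: eqVneq => //= eq_t.
  have := code_lt6 (s (inord i));
    rewrite -/(t i) ltnS leq_eqVlt => /orP[//|lt_t5].
  have lt_tj5 : (t j < 5)%N by rewrite -eq_t.
  have := congr1 vtx eq_t; rewrite /t (vtx_code lt_t5) (vtx_code lt_tj5).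
  by move/perm_inj/eqP; rewrite inord_inj // (negPf ne_ij).
have /allP/(_ _ (t_lt 0%N))/allP/(_ _ (t_lt 1%N)) := k23_check_all.
move=> /allP/(_ _ (t_lt 2))/allP/(_ _ (t_lt 3)); rewrite /k23_check.
rewrite !compat //; try lia.
rewrite [X in X ==> _]/= implyTb.
move=> /ZtoQ_ge0; rewrite ZtoQB subr_ge0 ZtoQM !ZtoQB ZtoQD !ZtoQ_nat.
by [].
Qed.

Lemma code_tperm a b u : (a < 5)%N -> (b < 5)%N ->
  code (tperm (vtx a) (vtx b) u) =
  if code u == a then b else if code u == b then a else code u.
Proof.
move=> a5 b5; case: tpermP => [->|->|ne_a ne_b].
- by rewrite !code_vtx // eqxx.
- by rewrite !code_vtx // eqxx; case: eqP => // ->.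
case: eqP => [ua|_]; first by case: ne_a; rewrite -ua vtx_code // ua.
by case: eqP => [ub|_] //; case: ne_b; rewrite -ub vtx_code // ub.
Qed.

(* Transposing two vertices of the K_{2,3} exchanges the two 4-sets. *)
Lemma sum_avoid a b : (a < 5)%N -> (b < 5)%N ->
  \sum_s avoid a s = \sum_s avoid b s.
Proof.
move=> a5 b5; rewrite [LHS](reindex_inj (mulIg (tperm (vtx a) (vtx b)))).
apply: eq_bigr => s _; rewrite /avoid !permM !code_tperm //; congr (_%:R).
have sw c : ((if c == a then b else if c == b then a else c) < 5)%N
    && ((if c == a then b else if c == b then a else c) != a) =
  (c < 5)%N && (c != b).
  case: (eqVneq c a) => [->|ne_ca]; first by rewrite a5 b5 eq_sym.
  by case: (eqVneq c b) => [->|ne_cb]; rewrite ?eqxx ?andbF // ne_ca.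
by rewrite /avoids /= !sw.
Qed.

(** After summation every vertex of K_{2,3} is omitted equally often, so the lower bound
    [quad_coef_ge_avoid] cancels to 0. *)
Lemma sum_quad_coef_ge0 : 0 <= \sum_s quad_coef (relabel G s).
Proof.
apply: le_trans (ler_sum _ (fun s _ => quad_coef_ge_avoid s)).
rewrite -mulr_sumr !(sumrB, big_split) /= (@sum_avoid 0 2) // (@sum_avoid 1 3)
  //.
by rewrite (_ : _ - _ = 0) ?mulr0 //; ring.
Qed.

End K23Case.

Lemma sum_ge0 :
  0 <= 16 * \sum_s base_coef (relabel G s) + (n%:R - 3) * \sum_s quad_coef
    (relabel G s).
Proof.
have [/K23P[i0 [i1 [l0 [l1 [l2 [uniq_v [adj0 adj1]]]]]]]|] := boolP (K23 G);
  last first.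
  by move/negP; apply: sum_ge0_generic.
apply: addr_ge0; last first.
  apply: mulr_ge0; first by rewrite subr_ge0 ler_nat; lia.
  exact: (sum_quad_coef_ge0 uniq_v adj0 adj1).
have VL_sum : 0 <= \sum_s spread_coef (relabel G s).
  by apply: sumr_ge0 => s _; apply/spread_coef_ge0/permuted_relabel.
by have := sum_spread_coef_le; lra.
Qed.

End Averaging.

(** * Lambda on symmetric polynomials and square graphs *)

Section SymmetricCoefficients.

Variable N : nat.
Notation n := N.+1.

Lemma symmetrization_sym (p : {mpoly rat[n]}) : symmetrization p \is symmetric.
Proof.
apply/issymP => t; rewrite /symmetrization raddf_sum /=.
rewrite [RHS](reindex_inj (mulIg t)).
by apply: eq_bigr => s _; rewrite msymMm.
Qed.

Lemma mnm_of_part_pad K l : (K <= n)%N -> (size l <= K)%N ->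
  mnm_of_part n l = (l ++ nseq (K - size l) 0) ++ nseq (n - K) 0 :> seq nat.
Proof.
move=> le_Kn le_lK; apply: (@eq_from_nth _ 0%N) => [|i].
  by rewrite !size_cat !size_nseq size_tuple; lia.
rewrite size_tuple => lt_in.
rewrite -[in LHS](inordK lt_in) -(tnth_nth 0%N) tnth_mktuple inordK //.
rewrite -catA -nseqD nth_cat; case: ltnP => // le_li.
by rewrite nth_default // nth_nseq if_same.
Qed.

Lemma sym_coef_perm K (F : {mpoly rat[n]}) l1 l2 : F \is symmetric ->
    (K <= n)%N -> (size l1 <= K)%N -> (size l2 <= K)%N ->
    perm_eq (l1 ++ nseq (K - size l1) 0%N) (l2 ++ nseq (K - size l2) 0%N) ->
  sym_coef F l1 = sym_coef F l2.
Proof.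
move=> symF le_Kn le1 le2 pe12; rewrite /sym_coef.
have /tuple_permP[s sE] : perm_eq (mnm_of_part n l1) (mnm_of_part n l2).
  by rewrite !(mnm_of_part_pad le_Kn) // perm_cat2r.
rewrite -(msym_coeff (mnm_of_part n l2) s symF); congr (_@__).
by apply/val_inj/val_inj; rewrite /= sE; apply: eq_map => i; rewrite -mnm_tnth.
Qed.

(** The tables list all rearrangements of each exponent padded to two or three entries. For instance
    96 = 16 * 3 * 2 for a pair exponent, 96 = 16 * 6 for a triple one, and 32 = 16 * 2 for (4, 4,
    4). *)
Lemma Lambda_tables (F : {mpoly rat[n]}) : (3 <= n)%N -> F \is symmetric ->
  Lambda F = 16 * (3 * table_coef pair_table F + table_coef triple_table F)
             + (n%:R - 3) * table_coef quad_table F.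
Proof.
move=> le_3n symF; have E := sym_coef_perm symF le_3n.
rewrite /table_coef !big_cons !big_nil /= -!/(sym_coef F _).
rewrite (E [:: 12; 0]%N [:: 12]%N) // (E [:: 0; 12]%N [:: 12]%N) //.
rewrite (E [:: 2; 10]%N [:: 10; 2]%N) // (E [:: 3; 9]%N [:: 9; 3]%N) //.
rewrite (E [:: 4; 8]%N [:: 8; 4]%N) // (E [:: 5; 7]%N [:: 7; 5]%N) //.
rewrite (E [:: 2; 8; 2]%N [:: 8; 2; 2]%N) // (E [:: 2; 2; 8]%N [:: 8; 2;
  2]%N) //.
rewrite (E [:: 7; 2; 3]%N [:: 7; 3; 2]%N) // (E [:: 3; 7; 2]%N [:: 7; 3;
  2]%N) //.
rewrite (E [:: 2; 7; 3]%N [:: 7; 3; 2]%N) // (E [:: 3; 2; 7]%N [:: 7; 3;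
  2]%N) //.
rewrite (E [:: 2; 3; 7]%N [:: 7; 3; 2]%N) // (E [:: 5; 3; 4]%N [:: 5; 4;
  3]%N) //.
rewrite (E [:: 4; 5; 3]%N [:: 5; 4; 3]%N) // (E [:: 3; 5; 4]%N [:: 5; 4;
  3]%N) //.
rewrite (E [:: 4; 3; 5]%N [:: 5; 4; 3]%N) // (E [:: 3; 4; 5]%N [:: 5; 4;
  3]%N) //.
rewrite /Lambda (_ : ZtoQ 2%coqZ = 2) // (_ : ZtoQ (-1)%coqZ = -1) // ZtoQ1.
move: (sym_coef F [:: 12]%N) (sym_coef F [:: 10; 2]%N) (sym_coef F [:: 9; 3]%N).
move: (sym_coef F [:: 8; 4]%N) (sym_coef F [:: 8; 2; 2]%N).
move: (sym_coef F [:: 7; 5]%N) (sym_coef F [:: 7; 3; 2]%N).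
move: (sym_coef F [:: 6; 6]%N) (sym_coef F [:: 5; 4; 3]%N).
move: (sym_coef F [:: 4; 4; 4]%N) (sym_coef F [:: 3; 3; 3; 3]%N) n%:R => *.
ring.
Qed.

Lemma Lambda_square_graph (G : multigraph n) (o : rel 'I_n) : (12 <= n)%N ->
    orientation o -> square_graph G -> graph_degree G = 12%N ->
  0 <= Lambda (symmetrization (graph_monomial G o)).
Proof.
move=> n_ge12 oP sqG degG; rewrite (graph_monomial_square oP sqG).
set h := fun i j => _; have hP : simple_graph h.
  by split=> [i j|i]; rewrite /h ?(mult_sym G i j) ?mult_loopless.
have h6 : edge_count h = 6%N.
  by have := graph_degree_count sqG; rewrite degG -/h; lia.
rewrite Lambda_tables ?symmetrization_sym //; last by lia.
have := sum_ge0 n_ge12 hP h6.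
rewrite symmetrization_square_monomial // !raddf_sum /base_coef /pair_coef
  /triple_coef /quad_coef.
by rewrite big_split /= -mulr_sumr.
Qed.

End SymmetricCoefficients.

(** * The discriminant of a quartic *)

(** Sparse integer polynomials: terms with their exponent vectors, where trailing zeros may be
    dropped, so that [[::]] also denotes the constant monomial. *)
Definition spoly := seq (Z * seq nat).

Fixpoint sadd_term (c : Z) (e : seq nat) (p : spoly) : spoly :=
  if p is (d, f) :: p' then
    if e == f then ((c + d)%coqZ, e) :: p' else (d, f) :: sadd_term c e p'
  else [:: (c, e)].

Definition sadd (p q : spoly) : spoly :=
  foldr (fun t r => sadd_term t.1 t.2 r) q p.

Fixpoint eadd (e f : seq nat) : seq nat :=
  match e, f with
  | a :: e', b :: f' => (a + b)%N :: eadd e' f'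
  | [::], _ => f
  | _, [::] => e
  end.

Definition sscale (c : Z) (e : seq nat) (p : spoly) : spoly :=
  [seq ((c * t.1)%coqZ, eadd e t.2) | t <- p].

Definition smul (p q : spoly) : spoly :=
  foldr (fun t r => sadd (sscale t.1 t.2 q) r) [::] p.

Definition sexp (p : spoly) (k : nat) : spoly := iter k (smul p) [:: (1%coqZ,
  [::])].

Definition sclean (p : spoly) : spoly := [seq t <- p | t.1 != 0%coqZ].

Fixpoint ssum (k j : nat) (f : nat -> spoly) : spoly :=
  if k is k'.+1 then sadd (f j) (ssum k' j.+1 f) else [::].

(** Expansion along the first row; testing for a zero entry first avoids expanding its minor, and
    Sylvester matrices are sparse. *)
Fixpoint slaplace (k : nat) (f : nat -> nat -> spoly) : spoly :=
  if k is k'.+1 then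
    ssum k 0 (fun j =>
      if f 0%N j is [::] then [::] else
      smul (sscale (if odd j then (-1)%coqZ else 1%coqZ) [::] (f 0%N j))
           (slaplace k' (fun a b => f a.+1 (bump j b))))
  else [:: (1%coqZ, [::])].

Section Evaluation.

Variable R : comNzRingType.
Implicit Types (x : seq R) (p q : spoly).

Fixpoint mon x (e : seq nat) : R :=
  match x, e with
  | y :: x', a :: e' => y ^+ a * mon x' e'
  | _, _ => 1
  end.

Definition seval x p : R := \sum_(t <- p) (int_of_Z t.1)%:~R * mon x t.2.

Lemma mon_eadd x e f : mon x (eadd e f) = mon x e * mon x f.
Proof.
elim: x e f => [|y x IH] [|a e] [|b f] //=; rewrite ?mulr1 ?mul1r //.
by rewrite IH exprD mulrACA.
Qed.

Lemma seval_add_term x c e p :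
  seval x (sadd_term c e p) = (int_of_Z c)%:~R * mon x e + seval x p.
Proof.
rewrite /seval; elim: p => [|[d f] p IH] /=;
  first by rewrite big_seq1 big_nil addr0.
case: eqP => [->|_]; last by rewrite !big_cons IH addrCA.
by rewrite !big_cons /= (raddfD int_of_Z c d) rmorphD mulrDl addrA.
Qed.

Lemma seval_add x p q : seval x (sadd p q) = seval x p + seval x q.
Proof.
rewrite {2}/seval; elim: p => [|t p IH] /=; first by rewrite big_nil add0r.
by rewrite seval_add_term IH big_cons addrA.
Qed.

Lemma seval_scale x c e p :
  seval x (sscale c e p) = (int_of_Z c)%:~R * mon x e * seval x p.
Proof.
rewrite /seval big_map mulr_sumr; apply: eq_bigr => t _ /=.
by rewrite (rmorphM int_of_Z c t.1) rmorphM mon_eadd mulrACA.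
Qed.

Lemma seval_mul x p q : seval x (smul p q) = seval x p * seval x q.
Proof.
rewrite {2}/seval; elim: p => [|t p IH] /=;
  first by rewrite big_nil mul0r /seval big_nil.
by rewrite seval_add seval_scale IH big_cons mulrDl.
Qed.

Lemma seval1 x : seval x [:: (1%coqZ, [::])] = 1.
Proof. by rewrite /seval big_seq1 /=; case: x => *; rewrite mulr1. Qed.

Lemma seval_exp x p k : seval x (sexp p k) = seval x p ^+ k.
Proof. by elim: k => [|k IH]; rewrite ?seval1 //= seval_mul IH exprS. Qed.

Lemma seval_clean x p : seval x (sclean p) = seval x p.
Proof.
rewrite /seval big_filter big_mkcond; apply: eq_bigr => t _ /=.
by case: eqP => // ->; rewrite mul0r.
Qed.

Fixpoint laplace (k : nat) (f : nat -> nat -> R) : R :=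
  if k is k'.+1 then
    \sum_(j < k) f 0%N j * ((-1) ^+ j * laplace k' (fun a b
      => f a.+1 (bump j b)))
  else 1.

Lemma det_laplace k (f : nat -> nat -> R) :
  \det (\matrix_(i < k, j < k) f i j) = laplace k f.
Proof.
elim: k f => [|k IH] f; first by rewrite det_mx00.
rewrite (expand_det_row _ ord0) /=; apply: eq_bigr => j _.
rewrite mxE /cofactor /= add0n -IH; congr (_ * (_ * \det _)).
by apply/matrixP => a b; rewrite !mxE.
Qed.

Lemma eq_laplace k f1 f2 : f1 =2 f2 -> laplace k f1 = laplace k f2.
Proof.
elim: k f1 f2 => //= k IH f1 f2 eqf; apply: eq_bigr => j _; rewrite eqf.
by congr (_ * (_ * _)); apply: IH => a b; apply: eqf.
Qed.

Lemma seval_sum x k j f : seval x (ssum k j f) = \sum_(i < k) seval x (f (j +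
  i)%N).
Proof.
elim: k j => [|k IH] j; first by rewrite /seval big_nil big_ord0.
rewrite [ssum _ _ _]/= seval_add IH big_ord_recl addn0; congr (_ + _).
by apply: eq_bigr => i _; rewrite lift0 addSnnS.
Qed.

Lemma seval_laplace x k f :
  seval x (slaplace k f) = laplace k (fun i j => seval x (f i j)).
Proof.
elim: k f => [|k IH] f; first exact: seval1.
rewrite -[slaplace _ _]/(ssum k.+1 0 (fun j =>
  if f 0%N j is [::] then [::] else
  smul (sscale (if odd j then (-1)%coqZ else 1%coqZ) [::] (f 0%N j))
       (slaplace k (fun a b => f a.+1 (bump j b))))) seval_sum [RHS]/=.
apply: eq_bigr => j _; rewrite add0n.
have -> (p q : spoly) : seval x (if p is [::] then [::] else q) =
    if p is [::] then 0 else seval x q by case: p => //; rewrite /seval big_nil.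
rewrite seval_mul seval_scale IH mulrA; case: (f 0%N j) => [|t p].
  by rewrite /seval big_nil !mul0r.
congr (_ * _); rewrite mulrC -signr_odd; congr (_ * _).
by rewrite (_ : mon x [::] = 1) ?mulr1; [case: odd | case: (x)].
Qed.

Lemma resultant_laplace (p q : {poly R}) : resultant p q =
  laplace ((size q).-1 + (size p).-1) (fun i j =>
    if (i < (size q).-1)%N then p`_(j - i) *+ (i <= j)
    else q`_(j - (i - (size q).-1)) *+ (i - (size q).-1 <= j)).
Proof.
rewrite -det_laplace /resultant; congr (\det _); apply/matrixP => i j.
by rewrite Sylvester_mxE mxE; case: splitP => k ->; rewrite ?addKn.
Qed.

End Evaluation.

(* The variables are the coefficients of t^3, t^2, t, 1 of a monic quartic. *)
Definition quartic_sylvester (i j : nat) : spoly :=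
  let c (z : Z) (e : seq nat) : spoly := [:: (z, e)] in
  let rowP := [:: c 1%coqZ [:: 0; 0; 0; 1]; c 1%coqZ [:: 0; 0; 1; 0];
                  c 1%coqZ [:: 0; 1; 0; 0]; c 1%coqZ [:: 1; 0; 0; 0];
                  c 1%coqZ [:: 0; 0; 0; 0]]%N in
  let rowD := [:: c 1%coqZ [:: 0; 0; 1; 0]; c 2%coqZ [:: 0; 1; 0; 0];
                  c 3%coqZ [:: 1; 0; 0; 0]; c 4%coqZ [:: 0; 0; 0; 0]]%N in
  if (i < 3)%N then if (i <= j)%N then nth [::] rowP (j - i) else [::]
  else if (i - 3 <= j)%N then nth [::] rowD (j - (i - 3)) else [::].

Definition quartic_disc : spoly := sclean (slaplace 7 quartic_sylvester).

(** The sign is trivial since C(4, 2) = 6 is even, and [4 != 0] keeps the derivative in degree 3, so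
    the Sylvester matrix is 7 by 7. *)
Lemma disc_quartic (R : comNzRingType) (p : {poly R}) :
    (4%:R != 0 :> R) -> size p = 5%N -> p`_4 = 1 ->
  disc_monic p = seval [:: p`_3; p`_2; p`_1; p`_0] quartic_disc.
Proof.
move=> neq0_4 sz_p p4.
have q0 : p^`()`_0 = p`_1 by rewrite coef_deriv.
have q1 : p^`()`_1 = p`_2 *+ 2 by rewrite coef_deriv.
have q2 : p^`()`_2 = p`_3 *+ 3 by rewrite coef_deriv.
have q3 : p^`()`_3 = 4%:R by rewrite coef_deriv p4.
have sz_q : size p^`() = 4%N.
  apply/anti_leq/andP; split.
    have := lt_size_deriv (p := p); rewrite -size_poly_eq0 sz_p => /(_ isT).
    by rewrite ltnS.
  by rewrite ltnNge; apply: contra neq0_4 => le_q3; rewrite -q3 nth_default.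
have p_hi k : p`_(k.+4.+1) = 0 by rewrite nth_default // sz_p.
have q_hi k : p^`()`_(k.+4) = 0 by rewrite nth_default // sz_q.
rewrite /disc_monic sz_p -signr_odd [odd _]/= mul1r.
rewrite resultant_laplace sz_p sz_q seval_clean seval_laplace.
apply: eq_laplace => i j; rewrite /quartic_sylvester.
have seval0 x : seval x [::] = 0 :> R by rewrite /seval big_nil.
have seval_mon x c e : seval x [:: (c, e)] = (int_of_Z c)%:~R * mon x e :> R.
  by rewrite /seval big_seq1.
case: ifP => _.
  case: leqP => _; last by rewrite seval0.
  case: (j - i)%N => [|[|[|[|[|k]]]]] /=;
    by rewrite ?p_hi ?nth_nil ?seval0 // seval_mon /= !mul1r ?mulr1.
case: leqP => _; last by rewrite seval0.
case: (j - _)%N => [|[|[|[|k]]]] /=; rewrite ?q_hi ?nth_nil ?seval0 //.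
- by rewrite q0 seval_mon /= !mul1r mulr1.
- by rewrite q1 seval_mon /= !mul1r !mulr1 mulrzl.
- by rewrite q2 seval_mon /= !mul1r !mulr1 mulrzl.
- by rewrite q3 seval_mon /= !mulr1.
Qed.

(** * The discriminant of J *)

(** This is (-1)^(k+1) e_(k+1) in four variables, the coefficient of t^(3-k) in the product of the t
    - x_i. *)
Definition xs_poly (k : nat) : spoly :=
  nth [::] [:: [:: (-1, [:: 1; 0; 0; 0]%N); (-1, [:: 0; 1; 0; 0]%N);
                   (-1, [:: 0; 0; 1; 0]%N); (-1, [:: 0; 0; 0; 1]%N)];
               [:: (1, [:: 1; 1; 0; 0]%N); (1, [:: 1; 0; 1; 0]%N);
                   (1, [:: 1; 0; 0; 1]%N); (1, [:: 0; 1; 1; 0]%N);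
                   (1, [:: 0; 1; 0; 1]%N); (1, [:: 0; 0; 1; 1]%N)];
               [:: (-1, [:: 1; 1; 1; 0]%N); (-1, [:: 1; 1; 0; 1]%N);
                   (-1, [:: 1; 0; 1; 1]%N); (-1, [:: 0; 1; 1; 1]%N)];
               [:: (1, [:: 1; 1; 1; 1]%N)]]%coqZ k.

Definition xs_monomial (e : seq nat) : spoly :=
  smul (sexp (xs_poly 0) (nth 0%N e 0)) (smul (sexp (xs_poly 1) (nth 0%N e 1))
  (smul (sexp (xs_poly 2) (nth 0%N e 2)) (sexp (xs_poly 3) (nth 0%N e 3)))).

Definition sweight (tab : coef_table) (p : spoly) : Z :=
  foldr (fun t z => (t.1 * table_weight tab t.2 + z)%coqZ) 0%coqZ p.

Definition main_table : coef_table :=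
  [:: (96, [:: 12; 0; 0; 0]%N); (96, [:: 10; 2; 0; 0]%N);
      (-96, [:: 9; 3; 0; 0]%N); (96, [:: 8; 4; 0; 0]%N);
      (96, [:: 8; 2; 2; 0]%N); (-96, [:: 7; 5; 0; 0]%N);
      (-96, [:: 7; 3; 2; 0]%N); (96, [:: 6; 6; 0; 0]%N);
      (96, [:: 5; 4; 3; 0]%N); (32, [:: 4; 4; 4; 0]%N)]%coqZ.


Definition disc_weights : seq (Z * seq nat * Z * Z) :=
  [seq (t.1, t.2, sweight main_table (xs_monomial t.2), sweight quad_table
    (xs_monomial t.2))
  | t <- quartic_disc].

(** The sixteen terms of the discriminant of a monic quartic, each with the values of [main_table]
    and [quad_table] on the matching product of signed elementary symmetric polynomials. *)
Lemma disc_weightsE : disc_weights =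
  [:: (-27, [:: 0; 0; 4; 0]%N, 32, 24); (144, [:: 0; 1; 2; 1]%N, 0, 12);
      (18, [:: 1; 1; 3; 0]%N, 192, 108); (-6, [:: 2; 0; 2; 1]%N, 0, 28);
      (-80, [:: 1; 2; 1; 1]%N, 0, 48); (-192, [:: 1; 0; 1; 2]%N, 0, 4);
      (-4, [:: 3; 0; 3; 0]%N, 480, 256); (18, [:: 3; 1; 1; 1]%N, 0, 108);
      (-4, [:: 0; 3; 2; 0]%N, 480, 204); (1, [:: 2; 2; 2; 0]%N, 1248, 480);
      (16, [:: 0; 4; 0; 1]%N, 0, 90); (-128, [:: 0; 2; 0; 2]%N, 0, 6);
      (144, [:: 2; 1; 0; 2]%N, 0, 12); (-4, [:: 2; 3; 0; 1]%N, 0, 204);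
      (-27, [:: 4; 0; 0; 2]%N, 0, 24); (256, [:: 0; 0; 0; 3]%N, 0, 1)]%coqZ.
Proof. by vm_compute. Qed.

Lemma size_xs_monomial : all (fun t => (size t.2 == 4%N) &&
  all (fun c => size c.2 == 4%N) (xs_monomial t.2)) quartic_disc.
Proof. by vm_compute. Qed.

Lemma eq_mon_map (R S : comNzRingType) (f : {rmorphism R -> S}) x e :
  mon (map f x) e = f (mon x e).
Proof.
elim: x e => [|y x IH] [|a e] /=; rewrite ?rmorph1 //.
by rewrite rmorphM rmorphXn IH.
Qed.

Lemma seval_map (R S : comNzRingType) (f : {rmorphism R -> S}) x p :
  seval (map f x) p = f (seval x p).
Proof.
rewrite /seval rmorph_sum; apply: eq_bigr => t _.
by rewrite rmorphM rmorph_int eq_mon_map.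
Qed.

Section Discriminant.

Variable N : nat.
Notation n := N.+1.
Hypothesis le_4n : (4 <= n)%N.

Definition xs : seq {mpoly rat[n]} := [:: var N 0; var N 1; var N 2; var N 3].

Lemma mon_xs e : size e = 4%N -> mon xs e = xpow N e.
Proof.
case: e => [|a [|b [|c [|d [|? ?]]]]] // _.
have := @xpowE N 4 (nth 0%N [:: a; b; c; d]) le_4n.
by rewrite /index_iota /= !big_cons big_nil => ->.
Qed.

Lemma table_coef_seval tab p : all (fun c => size c.2 == 4%N) tab ->
    all (fun c => size c.2 == 4%N) p ->
  table_coef tab (seval xs p) = ZtoQ (sweight tab p).
Proof.
move=> sz_tab; rewrite /seval; elim: p => [|t p IH].
  by rewrite big_nil raddf0.
rewrite [all _ _]/= => /andP[/eqP sz_t sz_p].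
rewrite big_cons mon_xs // raddfD /= IH // ZtoQD ZtoQM.
rewrite [in LHS]mulrzl (raddfMz (table_coef tab)) /= -mulrzl.
by rewrite (table_coef_xpow le_4n sz_t sz_tab).
Qed.

Lemma trunc_genericP : map_poly (trunc 4) (genericP n) =
  \prod_(0 <= i < 4) ('X - (var N i)%:P) * 'X^(n - 4).
Proof.
rewrite /genericP rmorph_prod.
pose F i : {poly {mpoly rat[n]}} := 'X - (trunc 4 (var N i))%:P.
have F_lt4 : \prod_(0 <= i < 4) F i = \prod_(0 <= i < 4) ('X - (var N i)%:P).
  apply: eq_big_nat => i /andP[_ lt_i4].
  by rewrite /F trunc_var ?lt_i4 //; apply: leq_trans lt_i4 le_4n.
have F_ge4 : \prod_(4 <= i < n) F i = 'X^(n - 4).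
  rewrite -prodr_const_nat; apply: eq_big_nat => i /andP[le_4i lt_in].
  by rewrite /F (trunc_var _ lt_in) ltnNge le_4i polyC0 subr0.
transitivity (\prod_(0 <= i < n) F i).
  rewrite big_mkord; apply: eq_bigr => i _.
  by rewrite rmorphB /= map_polyX map_polyC /= /F /var inord_val.
rewrite -F_lt4 -F_ge4; exact: big_cat_nat.
Qed.

Lemma prod_xs_coef k : (k < 4)%N ->
  (\prod_(0 <= i < 4) ('X - (var N i)%:P))`_(3 - k) = seval xs (xs_poly k).
Proof.
set a := var N 0; set b := var N 1; set c := var N 2; set d := var N 3.
have -> : \prod_(0 <= i < 4) ('X - (var N i)%:P) = 'X^4
    + (- a - b - c - d)%:P * 'X^3
    + (a * b + a * c + a * d + b * c + b * d + c * d)%:P * 'X^2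
    + (- (a * b * c) - a * b * d - a * c * d - b * c * d)%:P * 'X
    + (a * b * c * d)%:P.
  rewrite /index_iota /= !big_cons big_nil -/a -/b -/c -/d.
  by rewrite !(polyCD, polyCN, polyCM); ring.
rewrite /seval; case: k => [|[|[|[|//]]]] _.
all: rewrite !coefD !coefCM !coefXn coefX coefC /= !(mulr1, mulr0, addr0,
  add0r).
all: rewrite !big_cons big_nil /= !(expr0, expr1, mul1r, mulr1, addr0).
all: rewrite -/a -/b -/c -/d.
all: rewrite -?[(int_of_Z (-1)%coqZ)%:~R]/(-1 : {mpoly rat[n]}).
all: rewrite -?[(int_of_Z 1%coqZ)%:~R]/(1 : {mpoly rat[n]}).
all: ring.
Qed.

Lemma size_genericP : size (genericP n) = n.+1.
Proof. by rewrite /genericP size_prod_XsubC -[index_enum _]enumT size_enum_ord.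
Qed.

Lemma J_coef i : (J n 4)`_i =
  (4`!%:R / n`!%:R)%:MP * (genericP n)`_(n - 4 + i) *+ (n - 4 + i) ^_ (n - 4).
Proof. by rewrite /J coefZ coef_derivn mulrnAr. Qed.

Lemma J_coef4 : (J n 4)`_4 = 1.
Proof.
rewrite J_coef subnK // (_ : (genericP n)`_n = 1).
  rewrite mulr1 -mpolyCMn -[X in X%:MP]mulr_natl mulrA -natrM.
  rewrite -[X in (_ * X`!)%N](subKn le_4n) ffact_fact ?leq_subr //.
  by rewrite divff // pnatr_eq0 -lt0n fact_gt0.
have := monic_prod_XsubC (index_enum 'I_n) xpredT (fun i
  => 'X_i : {mpoly rat[n]}).
by move=> /monicP; rewrite /lead_coef -[\prod_(i <- _) _]/(genericP n)
  size_genericP.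
Qed.

Lemma size_J : size (J n 4) = 5%N.
Proof.
apply/anti_leq/andP; split; last first.
  by rewrite ltnNge; apply/negP => /leq_sizeP/(_ 4 (leqnn _))/eqP;
    rewrite J_coef4 oner_eq0.
apply/leq_sizeP => j le_5j;
  rewrite J_coef [_`_(_ + j)]nth_default ?mulr0 ?mul0rn //.
by rewrite size_genericP; lia.
Qed.

(** The value is C(4, k+1) / C(n, k+1), by which passing from P to J scales e_(k+1). *)
Definition kappa (k : nat) : rat :=
  4`!%:R / n`!%:R * ((n - 4 + (3 - k)) ^_ (n - 4))%:R.

Lemma trunc_J k : (k < 4)%N ->
  trunc 4 (J n 4)`_(3 - k) = (kappa k)%:MP * seval xs (xs_poly k).
Proof.
move=> lt_k4.
have -> : (kappa k)%:MP_[n] =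
    (4`!%:R / n`!%:R)%:MP *+ (n - 4 + (3 - k)) ^_ (n - 4).
  by rewrite -mpolyCMn -[X in _ = X%:MP_[_]]mulr_natr.
have tr_coef : trunc 4 (genericP n)`_(n - 4 + (3 - k)) = seval xs (xs_poly k).
  rewrite -coef_map trunc_genericP coefMXn ltnNge leq_addr /= addKn.
  exact: prod_xs_coef.
rewrite J_coef (raddfMn (trunc 4)) /= [RHS]mulrnAl; congr (_ *+ _).
rewrite (rmorphM (trunc 4)) /=.
by rewrite -tr_coef; congr (_ * _); apply: comp_mpolyC.
Qed.

Lemma kappaE (x := n%:R : rat) :
  [/\ kappa 0 = 4 / x, kappa 1 = 12 / (x * (x - 1)),
      kappa 2 = 24 / (x * (x - 1) * (x - 2))
    & kappa 3 = 24 / (x * (x - 1) * (x - 2) * (x - 3))].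
Proof.
have [M nE] : exists M, n = M.+4 by exists (n - 4)%N; rewrite -addn4 subnK.
have kE k : (k < 4)%N ->
    kappa k = 24 * (M + (3 - k))`!%:R / ((3 - k)`!%:R * n`!%:R).
  move=> lt_k4; rewrite -(ffact_fact (leq_addr (3 - k) M)) addKn natrM.
  rewrite /kappa (_ : n - 4 = M)%N; last by lia.
  have B0 : (3 - k)`!%:R != 0 :> rat by rewrite pnatr_eq0 -lt0n fact_gt0.
  have n0 : n`!%:R != 0 :> rat by rewrite pnatr_eq0 -lt0n fact_gt0.
  rewrite (_ : 4`!%:R = 24 :> rat) //.
  move: (3 - k)`!%:R n`!%:R (_ ^_ _)%:R B0 n0 => B F A B0 n0.
  by field; rewrite B0 n0.
have xE : x = M%:R + 4 by rewrite /x nE -addn4 natrD.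
have f_neq0 : M`!%:R != 0 :> rat by rewrite pnatr_eq0 -lt0n fact_gt0.
have M_ge0 : 0 <= M%:R :> rat by [].
have nF : n`!%:R = (M%:R + 4) * (M%:R + 3) * (M%:R + 2) * (M%:R + 1)
    * M`!%:R :> rat by rewrite nE !factS !natrM -!natr1; ring.
rewrite !kE // nF xE !(subnn, subn0, subSS) addn0 addn1 addn2 addn3.
rewrite !factS fact0 !natrM -!natr1.
have [n1 n2 n3 n4] : [/\ M%:R + 1 != 0 :> rat, M%:R + 2 != 0 :> rat,
    M%:R + 3 != 0 :> rat & M%:R + 4 != 0 :> rat].
  by split; apply: lt0r_neq0; lra.
move: M`!%:R f_neq0 => f f_neq0.
by split; field; do ?(apply/andP; split);
  first [exact: f_neq0 | apply: lt0r_neq0; lra].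
Qed.

Definition kappa_mon (e : seq nat) : rat :=
  kappa 0 ^+ nth 0%N e 0 * kappa 1 ^+ nth 0%N e 1
  * kappa 2 ^+ nth 0%N e 2 * kappa 3 ^+ nth 0%N e 3.

Lemma mpoly_4_neq0 : 4%:R != 0 :> {mpoly rat[n]}.
Proof. by rewrite -mpolyC_nat mpolyC_eq0. Qed.

Lemma mon_trunc_J e : size e = 4%N ->
  mon [:: trunc 4 (J n 4)`_3; trunc 4 (J n 4)`_2; trunc 4 (J n 4)`_1;
          trunc 4 (J n 4)`_0] e =
  (kappa_mon e)%:MP * seval xs (xs_monomial e).
Proof.
case: e => [|a [|b [|c [|d [|? ?]]]]] // _.
rewrite /xs_monomial !seval_mul !seval_exp /kappa_mon.
have E0 := trunc_J (isT : 0 < 4)%N; have E1 := trunc_J (isT : 1 < 4)%N.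
have E2 := trunc_J (isT : 2 < 4)%N; have E3 := trunc_J (isT : 3 < 4)%N.
rewrite [LHS]/= E0 E1 E2 E3.
move: (kappa 0) (kappa 1) (kappa 2) (kappa 3) => k0 k1 k2 k3.
rewrite !mpolyCM !rmorphXn /= !exprMn.
move: (seval _ _) (seval _ _) (seval _ _) (seval _ _) => s0 s1 s2 s3.
by ring.
Qed.

(** Truncation is a ring morphism, so it may be applied to the coefficients of J before they enter
    the discriminant. *)
Lemma table_coef_Delta tab : all (fun c => size c.2 == 4%N) tab ->
  table_coef tab (Delta n 4) = \sum_(t <- quartic_disc)
    ZtoQ t.1 * (kappa_mon t.2 * ZtoQ (sweight tab (xs_monomial t.2))).
Proof.
move=> sz_tab; rewrite -(table_coef_trunc _ sz_tab) /Delta.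
rewrite (disc_quartic mpoly_4_neq0 size_J J_coef4).
rewrite (_ : trunc 4 _ = seval [:: trunc 4 (J n 4)`_3; trunc 4 (J n 4)`_2;
    trunc 4 (J n 4)`_1; trunc 4 (J n 4)`_0] quartic_disc); last first.
  exact: esym (seval_map (trunc 4) _ _).
rewrite /seval raddf_sum big_seq [RHS]big_seq; apply: eq_bigr => t t_disc.
have /andP[/eqP sz_t sz_m] := allP size_xs_monomial _ t_disc.
rewrite (mon_trunc_J sz_t); move: (kappa_mon _) => k.
have linZ z (p : {mpoly rat[n]}) :
    table_coef tab (z%:~R * p) = z%:~R * table_coef tab p.
  by rewrite mulrzl raddfMz -mulrzl.
apply: (etrans (linZ _ _)); congr (_ * _).
have lin c (p : {mpoly rat[n]}) :
    table_coef tab (c%:MP * p) = c * table_coef tab p.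
  rewrite /table_coef mulr_sumr; apply: eq_bigr => u _.
  by rewrite mcoeffCM mulrCA.
by rewrite lin table_coef_seval.
Qed.

Lemma Lambda_main_table (F : {mpoly rat[n]}) :
  Lambda F = table_coef main_table F + (n%:R - 3) * table_coef quad_table F.
Proof.
have pad (l : seq nat) : (size l <= 4)%N ->
    F@_(mnm_of_part n (l ++ nseq (4 - size l) 0)) = sym_coef F l.
  move=> le_l4; congr (_@__); apply/mnmP => i; rewrite !mnmE nth_cat.
  by case: ltnP => // le_li; rewrite [RHS]nth_default // nth_nseq if_same.
rewrite /table_coef !big_cons !big_nil.
rewrite (pad [:: 12]%N) // (pad [:: 10; 2]%N) // (pad [:: 9; 3]%N) //.
rewrite (pad [:: 8; 4]%N) // (pad [:: 8; 2; 2]%N) // (pad [:: 7; 5]%N) //.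
rewrite (pad [:: 7; 3; 2]%N) // (pad [:: 6; 6]%N) // (pad [:: 5; 4; 3]%N) //.
rewrite (pad [:: 4; 4; 4]%N) // (pad [:: 3; 3; 3; 3]%N) // /Lambda.
rewrite (ZtoQ_nat 96 : ZtoQ 96 = _) (ZtoQN 96) (ZtoQ_nat 96 : ZtoQ 96 = _).
rewrite (ZtoQ_nat 32 : ZtoQ 32 = _) ZtoQ1.
move: (sym_coef F [:: 12]%N) (sym_coef F [:: 10; 2]%N) (sym_coef F [:: 9; 3]%N).
move: (sym_coef F [:: 8; 4]%N) (sym_coef F [:: 8; 2; 2]%N).
move: (sym_coef F [:: 7; 5]%N) (sym_coef F [:: 7; 3; 2]%N).
move: (sym_coef F [:: 6; 6]%N) (sym_coef F [:: 5; 4; 3]%N).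
move: (sym_coef F [:: 4; 4; 4]%N) (sym_coef F [:: 3; 3; 3; 3]%N) n%:R => *.
ring.
Qed.

Lemma Lambda_Delta : Lambda (Delta n 4) = \sum_(w <- disc_weights)
  ZtoQ w.1.1.1 * (kappa_mon w.1.1.2 * (ZtoQ w.1.2 + (n%:R - 3) * ZtoQ w.2)).
Proof.
rewrite Lambda_main_table (@table_coef_Delta main_table isT)
  (@table_coef_Delta quad_table isT).
rewrite /disc_weights [RHS]big_map mulr_sumr -big_split /=.
apply: eq_bigr => t _.
move: (ZtoQ t.1) (kappa_mon t.2) (sweight _ _) (sweight _ _) => z k a b.
by rewrite /=; ring.
Qed.

Lemma Lambda_Delta_eq : Lambda (Delta n 4) =
  - (2654208%:R * Q n
     / (n%:R ^+ 6 * (n%:R - 3) ^+ 2 * (n%:R - 2) ^+ 4 * (n%:R - 1) ^+ 5)).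
Proof.
rewrite Lambda_Delta disc_weightsE !big_cons big_nil /kappa_mon [X in X = _]/=.
have [-> -> -> ->] := kappaE.
(* The integer literals become rational numerals, after which the claim is an identity of rational
   functions in [n]. *)
rewrite (ZtoQN 27) (ZtoQN 6) (ZtoQN 80) (ZtoQN 192) (ZtoQN 4) (ZtoQN 128).
rewrite ?(ZtoQ_nat 256 : ZtoQ 256 = _).
rewrite ?(ZtoQ_nat 1248 : ZtoQ 1248 = _).
rewrite ?(ZtoQ_nat 480 : ZtoQ 480 = _).
rewrite ?(ZtoQ_nat 204 : ZtoQ 204 = _).
rewrite ?(ZtoQ_nat 192 : ZtoQ 192 = _).
rewrite ?(ZtoQ_nat 144 : ZtoQ 144 = _).
rewrite ?(ZtoQ_nat 128 : ZtoQ 128 = _).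
rewrite ?(ZtoQ_nat 108 : ZtoQ 108 = _).
rewrite ?(ZtoQ_nat 90 : ZtoQ 90 = _).
rewrite ?(ZtoQ_nat 80 : ZtoQ 80 = _).
rewrite ?(ZtoQ_nat 48 : ZtoQ 48 = _).
rewrite ?(ZtoQ_nat 32 : ZtoQ 32 = _).
rewrite ?(ZtoQ_nat 28 : ZtoQ 28 = _).
rewrite ?(ZtoQ_nat 27 : ZtoQ 27 = _).
rewrite ?(ZtoQ_nat 24 : ZtoQ 24 = _).
rewrite ?(ZtoQ_nat 18 : ZtoQ 18 = _).
rewrite ?(ZtoQ_nat 16 : ZtoQ 16 = _).
rewrite ?(ZtoQ_nat 12 : ZtoQ 12 = _).
rewrite ?(ZtoQ_nat 6 : ZtoQ 6 = _).
rewrite ?(ZtoQ_nat 4 : ZtoQ 4 = _).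
rewrite ZtoQ0 ZtoQ1 /Q.
have [x0 x1 x2 x3] : [/\ n%:R != 0 :> rat, n%:R - 1 != 0 :> rat,
    n%:R - 2 != 0 :> rat & n%:R - 3 != 0 :> rat].
  have : 4 <= n%:R :> rat by rewrite ler_nat.
  by move=> ?; split; apply: lt0r_neq0; lra.
move: (n%:R : rat) x0 x1 x2 x3 => x x0 x1 x2 x3.
by field; rewrite x0 x1 x2 x3.
Qed.

(** Expanded in powers of y = n - 23, Q has only positive coefficients, with constant term
    957456. *)
Lemma Q_gt0 : (23 <= n)%N -> 0 < Q n.
Proof.
move=> le_23n; rewrite /Q;
  have : 0 <= n%:R - 23 :> rat by rewrite subr_ge0 ler_nat.
set y := _ - _ => y_ge0; have -> : n%:R = y + 23 by rewrite subrK.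
have y2 := exprn_ge0 2 y_ge0; have y3 := exprn_ge0 3 y_ge0.
have y4 := exprn_ge0 4 y_ge0; have y5 := exprn_ge0 5 y_ge0.
have y6 := exprn_ge0 6 y_ge0; move: y y_ge0 y2 y3 y4 y5 y6 => y *.
by lra.
Qed.

End Discriminant.

Theorem lemma10 (n : nat) (hn : (12 <= n)%N) :
  (forall (G : multigraph n) (o : rel 'I_n),
     orientation o -> square_graph G -> graph_degree G = 12%N ->
     0 <= Lambda (symmetrization (graph_monomial G o)))
  /\ Lambda (Delta n 4)
     = - (2654208%:R * Q n
          / (n%:R ^+ 6 * (n%:R - 3) ^+ 2 * (n%:R - 2) ^+ 4 * (n%:R - 1) ^+ 5))
  /\ ((23 <= n)%N -> Lambda (Delta n 4) < 0).
Proof.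
(* Writing n as a successor makes [inord], and thus vertices named by natural numbers, available. *)
case: n hn => [//|N] n_ge12.
have le_4n : (4 <= N.+1)%N := leq_trans (isT : 4 <= 12)%N n_ge12.
split; first by move=> G o; apply: Lambda_square_graph.
have LambdaE := Lambda_Delta_eq le_4n.
split=> [|le_23n]; first exact LambdaE.
rewrite LambdaE => {LambdaE}.
have x_ge23 : 23 <= N.+1%:R :> rat by rewrite ler_nat.
rewrite oppr_lt0; apply: divr_gt0.
  by apply: mulr_gt0; [lra | apply: Q_gt0].
by do 2?[apply: mulr_gt0; last by apply: exprn_gt0; lra];
  apply: mulr_gt0; apply: exprn_gt0; lra.
Qed.
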